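(* Let $K$ be a field and let $A$ be a finite dimensional $K$-algebra. If $A$ is $\tau$-tilting infinite, then there are indecomposable $A$-modules with arbitrarily many composition factors; that is, for every positive integer $t$ there exists an indecomposable module in $\mathrm{mod}\,A$ with at least $t$ composition factors.
   Context: $K$ is an arbitrary field (not necessarily algebraically closed), and $\mathrm{mod}\,A$ is the category of finitely generated right $A$-modules. ''Module'' means object of $\mathrm{mod}\,A$. The number of composition factors of a module is its length (composition factors counted with multiplicity). Let $r$ be the number of isomorphism classes of simple $A$-modules (the rank of the Grothendieck group $K_0(A)$). Nakayama functor: $\nu=\mathrm{Hom}_K(\mathrm{Hom}_A(-,A),K)$. Auslander-Reiten translation: if $P_1\to P_0\to M\to 0$ is the minimal projective presentation of $M$, then $\tau M$ is the kernel of $\nu P_1\to\nu P_0$. A module $M$ is $\tau$-rigid if $\mathrm{Hom}_A(M,\tau M)=0$. A pair $(M,P)$ with $M$ a module and $P$ a projective module, both basic (no two distinct indecomposable direct summands in a decomposition of $M$, respectively of $P$, are isomorphic), is a $\tau$-rigid pair if $M$ is $\tau$-rigid and $\mathrm{Hom}_A(P,M)=0$. A $\tau$-rigid pair $(M,P)$ is a $\tau$-tilting pair if the number of pairwise non-isomorphic indecomposable direct summands of $M\oplus P$ is equal to $r$. $A$ is $\tau$-tilting finite if there are only finitely many $\tau$-tilting pairs up to isomorphism (by a known theorem of Demonet-Iyama-Jasso this is equivalent to there being only finitely many isomorphism classes of bricks in $\mathrm{mod}\,A$, a brick being a module whose endomorphism algebra is a division ring). $A$ is $\tau$-tilting infinite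 if it is not $\tau$-tilting finite. *)

(* Defs.v *)
From HB Require Import structures.
From mathcomp Require Import all_boot all_order all_algebra all_field.

Set Implicit Arguments.
Unset Strict Implicit.
Unset Printing Implicit Defensive.

Import GRing.Theory.
Local Open Scope ring_scope.

Section RightModules.
Variables (K : fieldType) (A : falgType K).

(* Objects of mod A.  As A is finite dimensional, a finitely generated right
   A-module is the same as a finite dimensional K-space with a K-linear unital
   right action; [ract M a x] is the product x.a, whence the order in [ractM]. *)
Record rmod : Type := RMod {
  rcar :> vectType K;
  ract : A -> 'End(rcar);
  ract_linear : linear ract;
  ract1 : ract 1 = \1%VF;
  ractM : forall a b, ract (a * b) = (ract b \o ract a)%VF
}.

Implicit Types M N P Q X Y T : rmod.

Definition rlinear M N (f : 'Hom(M, N)) : Prop :=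
  forall a x, f (ract M a x) = ract N a (f x).

Definition rcomm M N (a : A) (f : 'Hom(M, N)) : 'Hom(M, N) :=
  ((f \o ract M a) - (ract N a \o f))%VF.

Fact rcomm_is_linear M N a : linear (@rcomm M N a).
Proof.
move=> k f g; apply/lfunP=> x; rewrite /rcomm !lfun_simp /=.
by rewrite linearD linearZ /= scalerBr opprD addrACA.
Qed.

HB.instance Definition _ M N a :=
  GRing.isLinear.Build K 'Hom(M, N) 'Hom(M, N) _ (@rcomm M N a)
    (@rcomm_is_linear M N a).

(* Hom_A(M, N) as a K-subspace of Hom_K(M, N): commuting with a K-basis of A
   is the same as being A-linear, see [rHomP]. *)
Definition rHom M N : {vspace 'Hom(M, N)} :=
  (\bigcap_(a <- vbasis {:A}) lker (linfun (@rcomm M N a)))%VS.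

Lemma rHomP M N (f : 'Hom(M, N)) : reflect (rlinear f) (f \in rHom M N).
Proof.
have -> : (f \in rHom M N) = all (fun a => rcomm a f == 0) (vbasis {:A}).
  rewrite /rHom; elim: (tval (vbasis {:A})) => [|a s IHs] /=.
    by rewrite big_nil memvf.
  by rewrite big_cons memv_cap IHs memv_ker lfunE.
apply: (iffP allP) => [fA a x|fA a _]; last first.
  by apply/eqP/lfunP=> x; rewrite /rcomm !lfun_simp fA subrr.
have ractD V k b c (y : rcar V) :
    ract V (k *: b + c) y = k *: ract V b y + ract V c y.
  by rewrite ract_linear !lfun_simp.
have ract0 V (y : rcar V) : ract V 0 y = 0.
  by have := ractD V (-1) 0 0 y; rewrite scaleN1r addNr scaleN1r addNr.
rewrite (coord_vbasis (memvf a)).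
elim/big_rec: _ => [|i b _ IH]; first by rewrite !ract0 linear0.
rewrite !ractD linearD linearZ /= IH; congr (_ *: _ + _).
have /fA/eqP/lfunP/(_ x) : (vbasis {:A})`_i \in vbasis {:A}.
  by rewrite mem_nth // size_tuple.
by rewrite /rcomm !lfun_simp => /eqP; rewrite subr_eq0 => /eqP.
Qed.

Definition riso M N : Prop :=
  exists f : 'Hom(M, N), [/\ rlinear f, lker f = 0%VS & limg f = fullv].

Definition rzero M : Prop := \dim {:M} = 0%N.

Definition rsub M (U : {vspace M}) : Prop :=
  forall a x, x \in U -> ract M a x \in U.

Definition rsimple M : Prop :=
  ~ rzero M /\ forall U : {vspace M}, rsub U -> U = 0%VS \/ U = fullv.

(* A composition series of length n: the factor U i.+1 / U i is simple when
   there is no submodule strictly between U i and U i.+1. *)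
Definition has_length M (n : nat) : Prop :=
  exists U : nat -> {vspace M},
    [/\ U 0%N = 0%VS, U n = fullv,
        forall i, (i <= n)%N -> rsub (U i)
      & forall i, (i < n)%N ->
          [/\ (U i <= U i.+1)%VS, U i <> U i.+1
            & forall W : {vspace M}, rsub W -> (U i <= W <= U i.+1)%VS ->
                W = U i \/ W = U i.+1]].

Definition dsum_act M N (a : A) (x : M * N) : M * N :=
  (ract M a x.1, ract N a x.2).

Fact dsum_act_is_linear M N a : linear (@dsum_act M N a).
Proof. by move=> k x y; rewrite /dsum_act /= !linearP. Qed.

HB.instance Definition _ M N a :=
  GRing.isLinear.Build K (M * N)%type (M * N)%type _ (@dsum_act M N a)
    (@dsum_act_is_linear M N a).

Definition dsum_ract M N (a : A) : 'End((M * N)%type) :=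
  linfun (@dsum_act M N a).

Fact dsum_ract_linear M N : linear (@dsum_ract M N).
Proof.
move=> k a b; apply/lfunP=> x; rewrite /dsum_ract !lfun_simp /=.
by rewrite /dsum_act !ract_linear !lfun_simp.
Qed.

Fact dsum_ract1 M N : dsum_ract M N 1 = \1%VF.
Proof.
by apply/lfunP=> -[x y]; rewrite lfunE /= /dsum_act !ract1 !id_lfunE.
Qed.

Fact dsum_ractM M N a b :
  dsum_ract M N (a * b) = (dsum_ract M N b \o dsum_ract M N a)%VF.
Proof.
by apply/lfunP=> x; rewrite comp_lfunE !lfunE /= /dsum_act !ractM !comp_lfunE.
Qed.

Definition dsum M N : rmod :=
  RMod (@dsum_ract_linear M N) (@dsum_ract1 M N) (@dsum_ractM M N).

Definition indecomposable M : Prop :=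
  ~ rzero M /\ forall X Y, riso M (dsum X Y) -> rzero X \/ rzero Y.

Definition indec_summand M X : Prop :=
  indecomposable X /\ exists Y, riso M (dsum X Y).

(* M is the direct sum of the F i, via injections j i : F i -> M. *)
Definition is_dsum M n (F : 'I_n -> rmod) : Prop :=
  exists j : forall i, 'Hom(F i, M),
    [/\ forall i, rlinear (j i), forall i, lker (j i) = 0%VS,
        directv (\sum_i limg (j i))
      & (\sum_i limg (j i))%VS = fullv].

Definition basic M : Prop :=
  forall n (F : 'I_n -> rmod), (forall i, indecomposable (F i)) ->
    is_dsum M F -> forall i j, riso (F i) (F j) -> i = j.

Definition num_iso_classes (C : rmod -> Prop) (n : nat) : Prop :=
  exists F : 'I_n -> rmod,
    [/\ forall i, C (F i), forall i j, riso (F i) (F j) -> i = j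
      & forall X, C X -> exists i, riso X (F i)].

Definition rprojective P : Prop :=
  forall X Y (g : 'Hom(X, Y)) (h : 'Hom(P, Y)),
    rlinear g -> limg g = fullv -> rlinear h ->
    exists2 h' : 'Hom(P, X), rlinear h' & (g \o h')%VF = h.

Definition superfluous M (U : {vspace M}) : Prop :=
  forall W : {vspace M}, rsub W -> (W + U)%VS = fullv -> W = fullv.

(* P0 -> M and P1 -> ker p are projective covers. *)
Definition min_proj_pres P1 P0 M (f : 'Hom(P1, P0)) (p : 'Hom(P0, M)) : Prop :=
  [/\ [/\ rprojective P1, rprojective P0, rlinear f & rlinear p],
      limg p = fullv, limg f = lker p,
      superfluous (lker p) & superfluous (lker f)].

Fact reg_ractM a b : amulr (a * b) = (amulr b \o amulr a)%VF :> 'End(A).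
Proof. by apply/lfunP=> x; rewrite comp_lfunE !lfunE /= mulrA. Qed.

Fact reg_ract1 : amulr 1 = \1%VF :> 'End(A).
Proof. by apply/lfunP=> x; rewrite !lfunE /= mulr1. Qed.

Definition reg : rmod := RMod (@amulr_is_linear K A) reg_ract1 reg_ractM.

Definition rdual P : vectType K := subvs_of (rHom P reg).

(* The left A-module structure of Hom_A(P, A). *)
Definition rdual_lact P (a : A) (g : rdual P) : rdual P :=
  vsproj (rHom P reg) (amull a \o vsval g)%VF.

Fact rdual_lact_is_linear P a : linear (@rdual_lact P a).
Proof.
move=> k g h; rewrite /rdual_lact -linearP; congr (vsproj _ _).
by rewrite linearP /= comp_lfunDr comp_lfunZr.
Qed.

HB.instance Definition _ P a :=
  GRing.isLinear.Build K (rdual P) (rdual P) _ (@rdual_lact P a)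
    (@rdual_lact_is_linear P a).

Lemma rdual_lactE P a (g : rdual P) :
  vsval (rdual_lact a g) = (amull a \o vsval g)%VF.
Proof.
rewrite /rdual_lact vsprojK //; apply/rHomP => b x.
have /rHomP gA := subvsP g.
by rewrite !comp_lfunE gA !lfunE /= mulrA.
Qed.

Definition nak_act P (a : A) (phi : 'Hom(rdual P, K^o)) : 'Hom(rdual P, K^o) :=
  (phi \o linfun (@rdual_lact P a))%VF.

Fact nak_act_is_linear P a : linear (@nak_act P a).
Proof. by move=> k f g; rewrite /nak_act comp_lfunDl comp_lfunZl. Qed.

HB.instance Definition _ P a :=
  GRing.isLinear.Build K 'Hom(rdual P, K^o) 'Hom(rdual P, K^o) _ (@nak_act P a)
    (@nak_act_is_linear P a).

Definition nak_ract P (a : A) : 'End('Hom(rdual P, K^o)) :=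
  linfun (@nak_act P a).

Lemma nak_ractE P a (phi : 'Hom(rdual P, K^o)) (g : rdual P) :
  nak_ract P a phi g = phi (rdual_lact a g).
Proof. by rewrite lfunE /= /nak_act comp_lfunE lfunE. Qed.

Fact nak_ract_linear P : linear (@nak_ract P).
Proof.
move=> k a b; apply/lfunP=> phi; apply/lfunP=> g.
rewrite add_lfunE scale_lfunE add_lfunE scale_lfunE !nak_ractE -linearP.
congr (phi _); apply: val_inj.
rewrite linearP /= !rdual_lactE.
by apply/lfunP=> x; rewrite !lfun_simp /= mulrDl scalerAl.
Qed.

Fact nak_ract1 P : nak_ract P 1 = \1%VF.
Proof.
apply/lfunP=> phi; apply/lfunP=> g; rewrite nak_ractE id_lfunE.
congr (phi _); apply: val_inj; rewrite /= rdual_lactE.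
by apply/lfunP=> x; rewrite !lfun_simp /= mul1r.
Qed.

Fact nak_ractM P a b : nak_ract P (a * b) = (nak_ract P b \o nak_ract P a)%VF.
Proof.
apply/lfunP=> phi; apply/lfunP=> g; rewrite comp_lfunE !nak_ractE.
congr (phi _); apply: val_inj; rewrite /= !rdual_lactE.
by apply/lfunP=> x; rewrite !lfun_simp /= mulrA.
Qed.

(* The Nakayama functor on objects: Hom_K(Hom_A(P, A), K). *)
Definition nak P : rmod :=
  RMod (@nak_ract_linear P) (@nak_ract1 P) (@nak_ractM P).

Definition rdual_map P Q (f : 'Hom(P, Q)) (g : rdual Q) : rdual P :=
  vsproj (rHom P reg) (vsval g \o f)%VF.

Fact rdual_map_is_linear P Q f : linear (@rdual_map P Q f).
Proof.
move=> k g h; rewrite /rdual_map -linearP; congr (vsproj _ _).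
by rewrite linearP /= comp_lfunDl comp_lfunZl.
Qed.

HB.instance Definition _ P Q f :=
  GRing.isLinear.Build K (rdual Q) (rdual P) _ (@rdual_map P Q f)
    (@rdual_map_is_linear P Q f).

Lemma rdual_mapE P Q (f : 'Hom(P, Q)) (g : rdual Q) : rlinear f ->
  vsval (rdual_map f g) = (vsval g \o f)%VF.
Proof.
move=> fA; rewrite /rdual_map vsprojK //; apply/rHomP => b x.
by have /rHomP gA := subvsP g; rewrite !comp_lfunE fA gA.
Qed.

Definition nak_fun P Q (f : 'Hom(P, Q)) (phi : nak P) : nak Q :=
  (phi \o linfun (rdual_map f))%VF.

Fact nak_fun_is_linear P Q f : linear (@nak_fun P Q f).
Proof. by move=> k x y; rewrite /nak_fun comp_lfunDl comp_lfunZl. Qed.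

HB.instance Definition _ P Q f :=
  GRing.isLinear.Build K (nak P) (nak Q) _ (@nak_fun P Q f)
    (@nak_fun_is_linear P Q f).

(* The Nakayama functor on morphisms; meaningful only when f is A-linear. *)
Definition nak_map P Q (f : 'Hom(P, Q)) : 'Hom(nak P, nak Q) :=
  linfun (@nak_fun P Q f).

Lemma nak_map_rlinear P Q (f : 'Hom(P, Q)) : rlinear f -> rlinear (nak_map f).
Proof.
move=> fA a phi; apply/lfunP=> g.
rewrite [LHS](_ : _ = phi (rdual_lact a (rdual_map f g))); last first.
  by rewrite lfunE /= /nak_fun comp_lfunE nak_ractE lfunE.
rewrite nak_ractE lfunE /= /nak_fun comp_lfunE lfunE.
congr (phi _); apply: val_inj; rewrite /= rdual_lactE !rdual_mapE //.
by rewrite rdual_lactE comp_lfunA.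
Qed.

(* T is a tau M, i.e. a kernel of nak P1 -> nak P0 for a minimal projective
   presentation of M; this determines T up to isomorphism. *)
Definition is_tau M T : Prop :=
  exists P1 P0 (f : 'Hom(P1, P0)) (p : 'Hom(P0, M)) (i : 'Hom(T, nak P1)),
    min_proj_pres f p /\
    [/\ rlinear i, lker i = 0%VS & limg i = lker (nak_map f)].

Definition tau_rigid M : Prop :=
  exists T, is_tau M T /\ rHom M T = 0%VS.

Definition tau_rigid_pair M P : Prop :=
  [/\ basic M, basic P, rprojective P, tau_rigid M & rHom P M = 0%VS].

Definition tau_tilting_pair M P : Prop :=
  tau_rigid_pair M P /\
  exists r, num_iso_classes rsimple r /\
            num_iso_classes (indec_summand (dsum M P)) r.

End RightModules.

Definition tau_tilting_finite (K : fieldType) (A : falgType K) : Prop :=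
  exists n (F : 'I_n -> rmod A * rmod A),
    forall M P : rmod A, tau_tilting_pair M P ->
      exists i, riso M (F i).1 /\ riso P (F i).2.

Definition tau_tilting_infinite (K : fieldType) (A : falgType K) : Prop :=
  ~ tau_tilting_finite A.

(* Main.v *)
(* If all indecomposables have bounded length, they have bounded dimension, and
   so do both members of every tau-tilting pair, since these are basic with at
   most r indecomposable summands.  An indecomposable projective is determined
   by any simple quotient, so there are finitely many projectives of bounded
   dimension, and it remains to see that a tau-rigid module M is determined by
   the terms P1 and P0 of its minimal presentation f : P1 -> P0.

   By Auslander-Reiten duality, M is tau-rigid only if every h : P1 -> P0 has the
   form b f + f a, that is, if the orbit map of Aut P1 x Aut P0 at f has
   surjective derivative.  When K is infinite, all but finitely many points of
   any line through f are then isomorphic to f, so two such maps f and g are both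
   isomorphic to a common point of the line joining them.  When K is finite,
   Hom(P1, P0) is finite. *)
From HB Require Import structures.
Require Import Defs.
From mathcomp Require Import all_boot all_order all_algebra all_field zify.
From Stdlib Require Import Classical.

Set Implicit Arguments.
Unset Strict Implicit.
Unset Printing Implicit Defensive.

Import GRing.Theory VectorInternalTheory.
Local Open Scope ring_scope.

(** * Submodules, quotients and direct sums *)

Lemma lker0E (K : fieldType) (U V : vectType K) (f : 'Hom(U, V)) :
  lker f = 0%VS <-> injective f.
Proof. by split=> [/eqP/lker0P|/lker0P/eqP]. Qed.

Lemma limg_fullE (K : fieldType) (U V : vectType K) (f : 'Hom(U, V)) :
  limg f = fullv <-> forall y, exists x, f x = y.
Proof.
split=> [fT y|fT].
  have /memv_imgP[x _ ->] : y \in limg f by rewrite fT memvf.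
  by exists x.
by apply/vspaceP=> y; have [x <-] := fT y; rewrite !memvf memv_img ?memvf.
Qed.

Lemma dim_injective (K : fieldType) (U V : vectType K) (f : 'Hom(U, V)) :
  injective f -> (\dim {:U} <= \dim {:V})%N.
Proof.
move=> /lker0E kf; rewrite -(@limg_dim_eq _ _ _ f fullv) ?dimvS ?subvf //.
by rewrite kf capv0.
Qed.

Section Pairing.
Variables (K : fieldType) (U V W : vectType K).
Variables (f : 'Hom(W, U)) (g : 'Hom(W, V)).

Definition pair_fun (w : W) : U * V := (f w, g w).

Fact pair_fun_is_linear : linear pair_fun.
Proof. by move=> k x y; rewrite /pair_fun !linearP. Qed.

HB.instance Definition _ :=
  GRing.isLinear.Build K W (U * V)%type _ pair_fun pair_fun_is_linear.

Definition lpair : 'Hom(W, (U * V)%type) := linfun pair_fun.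

Lemma lpairE w : lpair w = (f w, g w).
Proof. by rewrite lfunE. Qed.

End Pairing.

Section Projections.
Variables (K : fieldType) (U V : vectType K).

Definition lfst : 'Hom((U * V)%type, U) := linfun fst.
Definition lsnd : 'Hom((U * V)%type, V) := linfun snd.

Lemma lfstE w : lfst w = w.1. Proof. by rewrite lfunE. Qed.
Lemma lsndE w : lsnd w = w.2. Proof. by rewrite lfunE. Qed.

End Projections.

Section Modules.
Variables (K : fieldType) (A : falgType K).
Implicit Types M N P Q X Y Z : rmod A.

Lemma ractME M a b (x : M) : ract M (a * b) x = ract M b (ract M a x).
Proof. by rewrite ractM comp_lfunE. Qed.

Lemma ract1E M (x : M) : ract M 1 x = x.
Proof. by rewrite ract1 id_lfunE. Qed.

Lemma rlinear_id M : rlinear (\1%VF : 'Hom(M, M)).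
Proof. by move=> a x; rewrite !id_lfunE. Qed.

Lemma rlinear_comp M N P (f : 'Hom(M, N)) (g : 'Hom(N, P)) :
  rlinear f -> rlinear g -> rlinear (g \o f)%VF.
Proof. by move=> fA gA a x; rewrite !comp_lfunE fA gA. Qed.

Lemma rlinear_add M N (f g : 'Hom(M, N)) :
  rlinear f -> rlinear g -> rlinear (f + g).
Proof. by move=> fA gA a x; rewrite !add_lfunE fA gA linearD. Qed.

Lemma rlinear_scale M N k (f : 'Hom(M, N)) : rlinear f -> rlinear (k *: f).
Proof. by move=> fA a x; rewrite !scale_lfunE fA linearZ. Qed.

Lemma rlinear_sub M N (f g : 'Hom(M, N)) :
  rlinear f -> rlinear g -> rlinear (f - g).
Proof.
by move=> fA gA; apply: rlinear_add => //; rewrite -scaleN1r; apply: rlinear_scale.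
Qed.

Lemma rsub_ker M N (f : 'Hom(M, N)) : rlinear f -> rsub (lker f).
Proof. by move=> fA a x; rewrite !memv_ker fA => /eqP->; rewrite linear0. Qed.

Lemma rsub_img M N (f : 'Hom(M, N)) U : rlinear f -> rsub U -> rsub (f @: U)%VS.
Proof.
by move=> fA sU a y /memv_imgP[x Ux ->]; rewrite -fA memv_img // sU.
Qed.

Lemma rsub_preim M N (f : 'Hom(M, N)) U : rlinear f -> rsub U -> rsub (f @^-1: U)%VS.
Proof.
by move=> fA sU a x; rewrite -!memv_preim fA; apply: sU.
Qed.

Lemma rsub_full M : rsub (fullv : {vspace M}).
Proof. by move=> a x _; rewrite memvf. Qed.

Lemma rsub0 M : rsub (0%VS : {vspace M}).
Proof. by move=> a x; rewrite !memv0 => /eqP->; rewrite linear0. Qed.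

Lemma rsub_add M (U V : {vspace M}) : rsub U -> rsub V -> rsub (U + V)%VS.
Proof.
move=> sU sV a _ /memv_addP[x Ux [y Vy ->]].
by rewrite linearD memv_add ?sU ?sV.
Qed.

Lemma rlinear_inv M N (f : 'Hom(M, N)) :
  rlinear f -> lker f = 0%VS -> limg f = fullv -> rlinear (f^-1)%VF.
Proof.
move=> fA kf fT a y; have [x <-] := (limg_fullE f).1 fT y.
by rewrite -fA !lker0_lfunK ?kf.
Qed.

Lemma riso_mutual M N : riso M N -> exists (f : 'Hom(M, N)) (g : 'Hom(N, M)),
  [/\ rlinear f, rlinear g, cancel f g & cancel g f].
Proof.
case=> f [fA kf fT]; exists f, (f^-1)%VF; split=> //.
- exact: rlinear_inv.
- by apply: lker0_lfunK; rewrite kf.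
by move=> y; rewrite limg_lfunVK // fT memvf.
Qed.

Lemma mutual_riso M N (f : 'Hom(M, N)) (g : 'Hom(N, M)) :
  rlinear f -> cancel f g -> cancel g f -> riso M N.
Proof.
move=> fA fK gK; exists f; split=> //; first by apply/lker0E/(can_inj fK).
by apply/limg_fullE=> y; exists (g y).
Qed.

Lemma riso_refl M : riso M M.
Proof.
by apply: (@mutual_riso _ _ \1%VF \1%VF) => [|x|x]; rewrite ?id_lfunE //;
  apply: rlinear_id.
Qed.

Lemma riso_sym M N : riso M N -> riso N M.
Proof. by case/riso_mutual=> f [g] [fA gA fK gK]; apply: (mutual_riso gA gK fK). Qed.

Lemma riso_trans N M P : riso M N -> riso N P -> riso M P.
Proof.
case/riso_mutual=> f [f'] [fA _ fK f'K] /riso_mutual[g [g'] [gA _ gK g'K]].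
apply: (@mutual_riso _ _ (g \o f)%VF (f' \o g')%VF); first exact: rlinear_comp.
  by move=> x; rewrite !comp_lfunE gK fK.
by move=> x; rewrite !comp_lfunE f'K g'K.
Qed.

Lemma riso_dim M N : riso M N -> \dim {:M} = \dim {:N}.
Proof.
case/riso_mutual=> f [g] [_ _ fK gK].
by apply/eqP; rewrite eqn_leq (dim_injective (can_inj fK)) (dim_injective (can_inj gK)).
Qed.

Lemma rzero_iso M N : rzero M -> rzero N -> riso M N.
Proof.
move=> M0 N0; have z0 (T : rmod A) (x : T) : rzero T -> x = 0.
  move=> /eqP; rewrite dimv_eq0 => /eqP T0.
  by apply/eqP; rewrite -memv0 -T0 memvf.
apply: (@mutual_riso _ _ 0 0) => [a x|x|x]; first by rewrite !zero_lfunE linear0.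
  by rewrite zero_lfunE [RHS]z0.
by rewrite zero_lfunE [RHS]z0.
Qed.

Section Submodule.
Variables (M : rmod A) (U : {vspace M}) (sU : rsub U).

Definition sub_act a (x : subvs_of U) : subvs_of U := vsproj U (ract M a (vsval x)).

Fact sub_act_is_linear a : linear (sub_act a).
Proof. by move=> k x y; rewrite /sub_act (linearP vsval) /= !linearP. Qed.

HB.instance Definition _ a :=
  GRing.isLinear.Build K (subvs_of U) (subvs_of U) _ (sub_act a)
    (sub_act_is_linear a).

Definition sub_ract a : 'End(subvs_of U) := linfun (sub_act a).

Lemma sub_ractE a x : vsval (sub_ract a x) = ract M a (vsval x).
Proof. by rewrite lfunE /= vsprojK // sU ?subvsP. Qed.

Fact sub_ract_linear : linear sub_ract.
Proof.
move=> k a b; apply/lfunP=> x; apply: val_inj.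
rewrite add_lfunE scale_lfunE /= !sub_ractE.
by rewrite ract_linear add_lfunE scale_lfunE.
Qed.

Fact sub_ract1 : sub_ract 1 = \1%VF.
Proof. by apply/lfunP=> x; apply: val_inj; rewrite /= sub_ractE ract1E id_lfunE. Qed.

Fact sub_ractM a b : sub_ract (a * b) = (sub_ract b \o sub_ract a)%VF.
Proof.
by apply/lfunP=> x; apply: val_inj; rewrite /= comp_lfunE !sub_ractE ractME.
Qed.

Definition submod : rmod A := RMod sub_ract_linear sub_ract1 sub_ractM.

Definition submod_incl : 'Hom(submod, M) := linfun (vsval : subvs_of U -> M).

Lemma submod_inclE x : submod_incl x = vsval x.
Proof. by rewrite lfunE. Qed.

Lemma submod_incl_linear : rlinear submod_incl.
Proof. by move=> a x; rewrite !submod_inclE sub_ractE. Qed.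

Lemma dim_submod : \dim {:submod} = \dim U.
Proof. by rewrite dimvf. Qed.

End Submodule.

Definition rmod0 : rmod A := submod (@rsub0 (reg A)).

Lemma rzero_rmod0 : rzero rmod0.
Proof. by rewrite /rzero dim_submod dimv0. Qed.

Section QuotientModule.
Variables (M : rmod A) (U : {vspace M}) (sU : rsub U).

(* The quotient by U is realised on a linear complement of U. *)
Let W : {vspace M} := (U^C)%VS.
Let pi : 'End(M) := daddv_pi W U.

Let piW x : pi x \in W. Proof. exact: memv_pi. Qed.

Let WU0 : (W :&: U)%VS = 0%VS. Proof. by rewrite capvC capv_compl. Qed.

Let piU x : x - pi x \in U.
Proof.
have xWU : x \in (W + U)%VS by rewrite addvC addv_complf memvf.
by rewrite -{1}(daddv_pi_add WU0 xWU) [_ + daddv_pi U W x]addrC addrK memv_pi.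
Qed.

Let pi_id x : x \in W -> pi x = x. Proof. exact: daddv_pi_id. Qed.

Let pi_eq0 x : (pi x == 0) = (x \in U).
Proof.
apply/eqP/idP=> [px0|Ux]; first by rewrite -[x]subr0 -px0.
apply/eqP; rewrite -memv0 -WU0 memv_cap piW /=.
by rewrite -[pi x](subKr x) memvB.
Qed.

(** The action compressed to [W] is multiplicative because [x - pi x] lies in [U], which the action
    preserves and [pi] kills. *)
Let pi_act a x : pi (ract M a (pi x)) = pi (ract M a x).
Proof.
apply/eqP; rewrite eq_sym -subr_eq0 -!linearB /= pi_eq0.
by rewrite sU.
Qed.

Definition quo_act a (x : subvs_of W) : subvs_of W :=
  vsproj W (pi (ract M a (vsval x))).

Fact quo_act_is_linear a : linear (quo_act a).
Proof. by move=> k x y; rewrite /quo_act (linearP vsval) /= !linearP. Qed.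

HB.instance Definition _ a :=
  GRing.isLinear.Build K (subvs_of W) (subvs_of W) _ (quo_act a)
    (quo_act_is_linear a).

Definition quo_ract a : 'End(subvs_of W) := linfun (quo_act a).

Let quo_ractE a x : vsval (quo_ract a x) = pi (ract M a (vsval x)).
Proof. by rewrite lfunE /= vsprojK. Qed.

Fact quo_ract_linear : linear quo_ract.
Proof.
move=> k a b; apply/lfunP=> x; apply: val_inj.
rewrite add_lfunE scale_lfunE /= !quo_ractE.
by rewrite ract_linear add_lfunE scale_lfunE linearP.
Qed.

Fact quo_ract1 : quo_ract 1 = \1%VF.
Proof.
apply/lfunP=> x; apply: val_inj; rewrite /= quo_ractE ract1E id_lfunE.
by rewrite pi_id ?subvsP.
Qed.

Fact quo_ractM a b : quo_ract (a * b) = (quo_ract b \o quo_ract a)%VF.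
Proof.
apply/lfunP=> x; apply: val_inj; rewrite /= comp_lfunE !quo_ractE ractME.
by rewrite pi_act.
Qed.

Definition quomod : rmod A := RMod quo_ract_linear quo_ract1 quo_ractM.

Lemma quotient_exists : exists N (p : 'Hom(M, N)),
  [/\ rlinear p, limg p = fullv & lker p = U].
Proof.
exists quomod, (linfun (vsproj W) \o pi)%VF.
have pE x : vsval ((linfun (vsproj W) \o pi)%VF x) = pi x.
  by rewrite comp_lfunE lfunE /= vsprojK.
split=> [a x||].
- by apply: val_inj; rewrite /= pE quo_ractE pE pi_act.
- apply/limg_fullE=> y; exists (vsval y); apply: val_inj.
  by rewrite /= pE pi_id ?subvsP.
apply/vspaceP=> x; rewrite memv_ker -pi_eq0 -pE.
by apply/eqP/eqP=> [->|x0]; rewrite ?linear0 //; apply: val_inj.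
Qed.

End QuotientModule.

Lemma dim_dsum M N : \dim {:dsum M N} = (\dim {:M} + \dim {:N})%N.
Proof. by rewrite !dimvf. Qed.

Lemma dsum_ractE M N a (x : dsum M N) :
  ract (dsum M N) a x = (ract M a x.1, ract N a x.2).
Proof. by rewrite /= lfunE. Qed.

Lemma rlinear_pair X M N (f : 'Hom(X, M)) (g : 'Hom(X, N)) :
  rlinear f -> rlinear g -> rlinear (lpair f g : 'Hom(X, dsum M N)).
Proof. by move=> fA gA a x; rewrite dsum_ractE !lpairE fA gA. Qed.

Lemma rlinear_fst M N : rlinear (lfst M N : 'Hom(dsum M N, M)).
Proof. by move=> a x; rewrite dsum_ractE !lfstE. Qed.

Lemma rlinear_snd M N : rlinear (lsnd M N : 'Hom(dsum M N, N)).
Proof. by move=> a x; rewrite dsum_ractE !lsndE. Qed.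

Lemma rlinear0 M N : rlinear (0 : 'Hom(M, N)).
Proof. by move=> a x; rewrite !zero_lfunE linear0. Qed.

Lemma riso_dsum M M' N N' :
  riso M M' -> riso N N' -> riso (dsum M N) (dsum M' N').
Proof.
case/riso_mutual=> f [f'] [fA f'A fK f'K] /riso_mutual[g [g'] [gA g'A gK g'K]].
apply: (@mutual_riso (dsum M N) (dsum M' N') (lpair (f \o lfst M N) (g \o lsnd M N))%VF
          (lpair (f' \o lfst M' N') (g' \o lsnd M' N'))%VF).
- apply: rlinear_pair; apply: rlinear_comp => //; [exact: rlinear_fst | exact: rlinear_snd].
- by case=> x y; rewrite !lpairE !comp_lfunE /= !lfstE !lsndE /= fK gK.
by case=> x y; rewrite !lpairE !comp_lfunE /= !lfstE !lsndE /= f'K g'K.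
Qed.

Lemma riso_dsum_sub M (U V : {vspace M}) (sU : rsub U) (sV : rsub V) :
  (U :&: V = 0)%VS -> (U + V = fullv)%VS -> riso M (dsum (submod sU) (submod sV)).
Proof.
move=> UV0 UVT; apply: riso_sym.
pose i := submod_incl sU; pose j := submod_incl sV.
pose f := ((i \o lfst (submod sU) (submod sV))
           + (j \o lsnd (submod sU) (submod sV)))%VF.
have fE x : f x = vsval x.1 + vsval x.2.
  by rewrite add_lfunE !comp_lfunE lfstE lsndE !submod_inclE.
exists f; split.
- apply: rlinear_add; apply: rlinear_comp; try exact: submod_incl_linear.
    exact: rlinear_fst.
  exact: rlinear_snd.
- apply/lker0E=> x y; rewrite !fE => /eqP.
  have /directv_addP dUV := UV0.
  rewrite (directv_add_unique dUV) ?subvsP // => /andP[/eqP e1 /eqP e2].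
  by case: x y e1 e2 => [x1 x2] [y1 y2] /= /val_inj-> /val_inj->.
apply/limg_fullE=> y.
have /memv_addP[u Uu [v Vv ->]] : y \in (U + V)%VS by rewrite UVT memvf.
by exists (vsproj U u, vsproj V v); rewrite fE /= !vsprojK.
Qed.

(** Direct summands are recorded by a section and a retraction: this form composes without naming
    complements, and [split_mono_complement] recovers one when needed. *)
Definition split_mono X M : Prop := exists (i : 'Hom(X, M)) (q : 'Hom(M, X)),
  [/\ rlinear i, rlinear q & cancel i q].

Lemma split_mono_id M : split_mono M M.
Proof.
by exists \1%VF, \1%VF; split=> [||x]; rewrite ?id_lfunE //; exact: rlinear_id.
Qed.

Lemma split_mono_trans Y X M : split_mono X Y -> split_mono Y M -> split_mono X M.
Proof.
case=> i [q] [iA qA iK] [j] [r] [jA rA jK].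
exists (j \o i)%VF, (q \o r)%VF; split; try exact: rlinear_comp.
by move=> x; rewrite !comp_lfunE jK iK.
Qed.

Lemma split_mono_iso X M : riso X M -> split_mono X M.
Proof. by case/riso_mutual=> f [g] [fA gA fK _]; exists f, g. Qed.

Lemma split_mono_dsuml X Y : split_mono X (dsum X Y).
Proof.
exists (lpair \1%VF 0), (lfst X Y); split.
- by apply: rlinear_pair; [exact: rlinear_id | exact: rlinear0].
- exact: rlinear_fst.
by move=> x; rewrite lfstE lpairE id_lfunE.
Qed.

Lemma split_mono_dsumr X Y : split_mono Y (dsum X Y).
Proof.
exists (lpair 0 \1%VF), (lsnd X Y); split.
- by apply: rlinear_pair; [exact: rlinear0 | exact: rlinear_id].
- exact: rlinear_snd.
by move=> x; rewrite lsndE lpairE id_lfunE.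
Qed.

(** The idempotent [i \o q] splits [M] into its image, a copy of [X], and [lker q]. *)
Lemma split_mono_complement X M :
  split_mono X M -> exists Y, riso M (dsum X Y).
Proof.
case=> i [q] [iA qA iK].
have sk := rsub_ker qA; have si := rsub_img iA (@rsub_full X).
exists (submod sk); apply: riso_trans (riso_dsum_sub si sk _ _) _.
- apply/eqP; rewrite -subv0; apply/subvP=> _ /memv_capP[/memv_imgP[x _ ->]].
  by rewrite memv_ker iK => /eqP->; rewrite linear0 mem0v.
- apply/vspaceP=> x; rewrite memvf -[x](subrK (i (q x))) addrC memv_add //.
    by rewrite memv_img ?memvf.
  by rewrite memv_ker linearB /= iK subrr.
apply: riso_dsum (riso_refl _); apply: riso_sym.
pose f : 'Hom(X, submod si) := (linfun (vsproj (limg i)) \o i)%VF.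
have fE x : vsval (f x) = i x.
  by rewrite comp_lfunE lfunE /= vsprojK ?memv_img ?memvf.
exists f; split=> [a x||].
- by apply: val_inj; apply: etrans (fE _) _; rewrite iA -fE -sub_ractE.
- by apply/lker0E=> x y fxy; apply: (can_inj iK); rewrite -!fE fxy.
apply/limg_fullE=> y; have /memv_imgP[x _ yE] := subvsP y.
by exists x; apply: val_inj; apply: etrans (fE x) _.
Qed.

End Modules.

(** * Composition series and the Fitting lemma *)

Lemma dim_proper (K : fieldType) (V : vectType K) (U W : {vspace V}) :
  (U <= W)%VS -> U <> W -> (\dim U < \dim W)%N.
Proof.
move=> sUW nUW; rewrite ltnNge; apply/negP=> leWU; apply: nUW.
by apply/eqP; rewrite eqEdim sUW.
Qed.

Section Structure.
Variables (K : fieldType) (A : falgType K).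
Implicit Types M N P Q X Y Z S : rmod A.

Definition maximal_in M (W V : {vspace M}) : Prop :=
  [/\ rsub W, (W <= V)%VS, W <> V
    & forall U, rsub U -> (W <= U <= V)%VS -> U = W \/ U = V].

Lemma maximal_in_exists M (V : {vspace M}) :
  rsub V -> V <> 0%VS -> exists W, maximal_in W V.
Proof.
(* The induction is on the codimension in [V] of a proper submodule [U], which starts as the zero
   submodule and is enlarged until it is maximal. *)
move=> sV nV0; suff /(_ (\dim V) 0%VS) : forall n (U : {vspace M}),
    rsub U -> (U <= V)%VS -> U <> V -> (\dim V - \dim U <= n)%N ->
    exists W, maximal_in W V.
  by apply; rewrite ?sub0v ?leq_subr //; [exact: rsub0 | exact/nesym].
elim=> [|n IHn] U sU UV nUV leUn; have ltUV := dim_proper UV nUV; first by lia.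
case: (classic (maximal_in U V)) => [|nmaxU]; first by exists U.
have [W [sW /andP[UW WV] nWU nWV]] :
    exists W, [/\ rsub W, (U <= W <= V)%VS, W <> U & W <> V].
  apply: NNPP => noW; apply: nmaxU; split=> // W sW UWV.
  by apply: NNPP => /not_or_and[nWU nWV]; apply: noW; exists W.
apply: (IHn W) => //; have := dim_proper UW (nesym nWU); lia.
Qed.

Lemma simple_quotient M : ~ rzero M ->
  exists S (p : 'Hom(M, S)), [/\ rsimple S, rlinear p & limg p = fullv].
Proof.
move=> nM0; have nfull0 : {:M}%VS <> 0%VS by move/eqP; rewrite -dimv_eq0 => /eqP.
have [W [sW _ nWM maxW]] := maximal_in_exists (@rsub_full _ _ M) nfull0.
have [S [p [pA pT pk]]] := quotient_exists sW.
exists S, p; split=> //; split=> [S0|U sU].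
  apply: nWM; apply/vspaceP=> x; rewrite memvf -pk memv_ker.
  by move/eqP: S0; rewrite dimv_eq0 -memv0 => /eqP<-; rewrite memvf.
have UE : U = (p @: (p @^-1: U))%VS by rewrite lpreimK // pT subvf.
have [] := maxW _ (rsub_preim pA sU).
- by rewrite subvf -pk -lpreim0 lpreimS ?sub0v.
- move=> UW; left; rewrite UE UW -pk; apply/eqP.
  by rewrite -subv0; apply/subvP=> _ /memv_imgP[x + ->]; rewrite memv_ker memv0.
by move=> UT; right; rewrite UE UT.
Qed.

Definition ract_app M (x : M) (a : A) : M := ract M a x.

Fact ract_app_is_linear M (x : M) : linear (ract_app x).
Proof. by move=> k a b; rewrite /ract_app ract_linear add_lfunE scale_lfunE. Qed.

HB.instance Definition _ M (x : M) :=
  GRing.isLinear.Build K A M _ (ract_app x) (ract_app_is_linear x).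

Definition cyclic M (x : M) : {vspace M} := limg (linfun (ract_app x)).

Lemma cyclicP M (x y : M) : reflect (exists a, y = ract M a x) (y \in cyclic x).
Proof.
apply: (iffP memv_imgP) => [[a _ ->]|[a ->]]; exists a; rewrite ?memvf //.
  by rewrite lfunE.
by rewrite lfunE.
Qed.

Lemma rsub_cyclic M (x : M) : rsub (cyclic x).
Proof. by move=> b _ /cyclicP[a ->]; apply/cyclicP; exists (a * b); rewrite ractME. Qed.

Lemma mem_cyclic M (x : M) : x \in cyclic x.
Proof. by apply/cyclicP; exists 1; rewrite ract1E. Qed.

Lemma dim_cyclic M (x : M) : (\dim (cyclic x) <= \dim {:A})%N.
Proof. by rewrite -(limg_ker_dim (linfun (ract_app x)) fullv) leq_addl. Qed.

Lemma has_length_exists M : exists n, has_length M n.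
Proof.
suff series d : forall V : {vspace M}, rsub V -> (\dim V <= d)%N ->
    exists n (U : nat -> {vspace M}),
    [/\ U 0%N = 0%VS, U n = V, forall i, (i <= n)%N -> rsub (U i)
      & forall i, (i < n)%N -> [/\ (U i <= U i.+1)%VS, U i <> U i.+1
        & forall W : {vspace M}, rsub W -> (U i <= W <= U i.+1)%VS ->
          W = U i \/ W = U i.+1]].
  have [n [U [U0 Un sU cU]]] := series _ _ (@rsub_full _ _ M) (leqnn _).
  by exists n, U.
elim: d => [|d IHd] V sV leVd.
  exists 0%N, (fun=> 0%VS); split=> //; last by move=> i _; exact: rsub0.
  by move: leVd; rewrite leqn0 dimv_eq0 => /eqP->.
case: (classic (V = 0%VS)) => [V0|nV0].
  by exists 0%N, (fun=> 0%VS); split=> // i _; exact: rsub0.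
have [W [sW WV nWV maxW]] := maximal_in_exists sV nV0.
have [|n [U [U0 Un sU cU]]] := IHd W sW; first by have := dim_proper WV nWV; lia.
(* A series of the maximal submodule [W] is extended by [V] at the index [n.+1]. *)
exists n.+1, (fun i => if (i <= n)%N then U i else V).
rewrite leq0n ltnn; split=> // i; first by case: ifP => [/sU|].
rewrite ltnS => lein; rewrite lein; case: ltnP => [/cU //|leni].
have -> : i = n by apply/eqP; rewrite eqn_leq lein leni.
by rewrite Un; split.
Qed.

(** A simple factor is generated by the class of any element [x] outside the smaller term, so it is
    a quotient of [cyclic x] and has dimension at most that of [A]. *)
Lemma has_length_dim M n : has_length M n -> (\dim {:M} <= n * \dim {:A})%N.
Proof.
case=> U [U0 Un sU cU]; rewrite -Un.
suff : forall i, (i <= n)%N -> (\dim (U i) <= i * \dim {:A})%N by apply.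
elim=> [|i IHi] ltin; first by rewrite U0 dimv0.
have [UU' nUU' simpU] := cU i ltin.
have [x U'x nUx] : exists2 x, x \in U i.+1 & x \notin U i.
  by apply/subvPn/negP=> U'U; apply: nUU'; apply: subv_anti; rewrite UU'.
have xU' : (cyclic x <= U i.+1)%VS.
  by apply/subvP=> _ /cyclicP[a ->]; apply: (sU i.+1).
have sUx := rsub_add (sU i (ltnW ltin)) (@rsub_cyclic _ x).
have [|E|<-] := simpU _ sUx; first by rewrite addvSl subv_add UU'.
  by case/negP: nUx; rewrite -E; apply: (subvP (addvSr _ _)); exact: mem_cyclic.
have := (dimv_add_leqif (U i) (cyclic x)).1; have := IHi (ltnW ltin).
by have := dim_cyclic x; rewrite mulSn; lia.
Qed.

Definition lpow M (h : 'End(M)) k : 'End(M) := iter k (comp_lfun h) \1%VF.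

Lemma lpowE M (h : 'End(M)) k x : lpow h k x = iter k h x.
Proof. by elim: k => [|k IHk] /=; rewrite ?id_lfunE ?comp_lfunE ?IHk. Qed.

Lemma rlinear_lpow M (h : 'End(M)) k : rlinear h -> rlinear (lpow h k).
Proof.
by move=> hA; elim: k => [|k IHk] /=; [exact: rlinear_id | exact: rlinear_comp].
Qed.

Lemma bounded_argmax (f : nat -> nat) b :
  (forall k, f k <= b)%N -> exists k, forall j, (f j <= f k)%N.
Proof.
move=> fb; suff /(_ b 0%N) : forall n k, (b - f k <= n)%N ->
    exists k, forall j, (f j <= f k)%N by apply; lia.
elim=> [|n IHn] k lek; first by exists k => j; have := fb j; lia.
case: (classic (forall j, f j <= f k)%N) => [|/not_all_ex_not[j nj]]; first by exists k.
by apply: (IHn j); move/negP: nj; lia.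
Qed.

(** Once the kernels of the powers of [h] stop growing, the kernel and the image of such a power [u]
    are complementary submodules, and indecomposability makes one of them zero. *)
Lemma fitting M (h : 'End(M)) : indecomposable M -> rlinear h ->
  lker h = 0%VS \/ exists k, forall x, iter k h x = 0.
Proof.
move=> [nM0 indM] hA.
(* Only positive exponents are compared, so that [lker h] is contained in [lker u] and vanishes with
   it. *)
have [k kmax] : exists k, forall j,
    (\dim (lker (lpow h j.+1)) <= \dim (lker (lpow h k.+1)))%N.
  by apply: (@bounded_argmax _ (\dim {:M})) => k; rewrite dimvS ?subvf.
set u := lpow h k.+1 in kmax.
have uA : rlinear u by apply: rlinear_lpow.
have uuk x : u (u x) = 0 -> u x = 0.
  have sk : (lker u <= lker (lpow h (k + k.+1).+1))%VS.
    apply/subvP=> y; rewrite !memv_ker !lpowE -addSn iterD => /eqP->.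
    by elim: (k.+1) => //= j /eqP->; rewrite linear0.
  have/eqP kE : lker u == lker (lpow h (k + k.+1).+1) by rewrite eqEdim sk kmax.
  move=> uux; apply/eqP.
  by rewrite -memv_ker kE memv_ker lpowE -addSn iterD -!lpowE uux.
have cap0 : (lker u :&: limg u = 0)%VS.
  apply/eqP; rewrite -subv0; apply/subvP=> y /memv_capP[ky /memv_imgP[x _ yE]].
  by move: ky; rewrite yE memv_ker memv0 => /eqP/uuk->.
have full : (lker u + limg u = fullv)%VS.
  apply/eqP; rewrite eqEdim subvf /= dimv_disjoint_sum //.
  by rewrite -(limg_ker_dim u fullv) capfv.
have sk := rsub_ker uA; have si := rsub_img uA (@rsub_full _ _ M).
case: (indM _ _ (riso_dsum_sub sk si cap0 full)); rewrite /rzero dim_submod => /eqP.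
  rewrite dimv_eq0 => /eqP uk0; left; apply/eqP; rewrite -subv0 -uk0.
  apply/subvP=> x; rewrite !memv_ker lpowE iterSr => /eqP->.
  by elim: (k) => //= j /eqP->; rewrite linear0.
rewrite dimv_eq0 => /eqP ui0; right; exists k.+1 => x; apply/eqP.
by rewrite -lpowE -memv0 -ui0 memv_img ?memvf.
Qed.

End Structure.

(** * Decompositions and projective modules *)

Section Decomposition.
Variables (K : fieldType) (A : falgType K).
Implicit Types M N P Q X Y Z S : rmod A.

Lemma rzeroPn M : ~ rzero M <-> (0 < \dim {:M})%N.
Proof. by rewrite lt0n; split=> [nM0|/eqP//]; apply/eqP. Qed.

Lemma indec_split_summand M :
  ~ rzero M -> exists2 X, indecomposable X & split_mono X M.
Proof.
have [d] := ubnP (\dim {:M}); elim: d M => // d IHd M leMd nM0.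
case: (classic (indecomposable M)) => [indM|nindM].
  by exists M => //; exact: split_mono_id.
have [X [Y [MXY nX0 nY0]]] : exists X Y, [/\ riso M (dsum X Y), ~ rzero X & ~ rzero Y].
  apply: NNPP => noXY; apply: nindM; split=> // X Y MXY.
  by apply: NNPP => /not_or_and[nX0 nY0]; apply: noXY; exists X, Y.
have := riso_dim MXY; rewrite dim_dsum => dM; move/rzeroPn: nY0 => Y_gt0.
have [|Z indZ ZX] := IHd X _ nX0; first by lia.
exists Z => //; apply: split_mono_trans ZX _.
apply: split_mono_trans (split_mono_dsuml X Y) _.
exact/split_mono_iso/riso_sym.
Qed.

Lemma is_dsum0 M (F : 'I_0 -> rmod A) : rzero M -> is_dsum M F.
Proof.
move=> /eqP; rewrite dimv_eq0 => /eqP M0; exists (fun=> 0); split.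
- by case.
- by case.
- by apply/directv_sum_independent=> us _ _ [].
by rewrite big_ord0 M0.
Qed.

Lemma is_dsumS M X Y n (F : 'I_n -> rmod A) : riso M (dsum X Y) ->
  is_dsum Y F -> is_dsum M (fun i => oapp F X (unlift ord0 i)).
Proof.
move=> MXY [j [jA jk jdir jT]].
have [e [e' [eA e'A eK e'K]]] := riso_mutual MXY.
pose r : 'Hom(X, M) := (e' \o lpair \1%VF 0)%VF.
pose s : 'Hom(Y, M) := (e' \o lpair 0 \1%VF)%VF.
pose p : 'Hom(M, X) := (lfst X Y \o e)%VF.
pose q : 'Hom(M, Y) := (lsnd X Y \o e)%VF.
have rE x : r x = e' (x, 0) by rewrite comp_lfunE lpairE id_lfunE zero_lfunE.
have sE y : s y = e' (0, y) by rewrite comp_lfunE lpairE id_lfunE zero_lfunE.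
have pE x : p x = (e x).1 by rewrite comp_lfunE lfstE.
have qE x : q x = (e x).2 by rewrite comp_lfunE lsndE.
have pr : cancel r p by move=> x; rewrite pE rE e'K.
have ps y : p (s y) = 0 by rewrite pE sE e'K.
have qs : cancel s q by move=> y; rewrite qE sE e'K.
have rpsq x : x = r (p x) + s (q x).
  rewrite rE sE pE qE -linearD /= -[LHS]eK; congr (e' _).
  by case: (e x) => a b; congr (_, _); rewrite ?addr0 ?add0r.
have rA : rlinear r.
  apply: rlinear_comp => //; apply: rlinear_pair; [exact: rlinear_id | exact: rlinear0].
have sA : rlinear s.
  apply: rlinear_comp => //; apply: rlinear_pair; [exact: rlinear0 | exact: rlinear_id].
(* Matching on the option itself lets the source of the injection follow the [oapp] of the
   statement. *)
pose jo o : 'Hom(oapp F X o, M) :=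
  match o with Some i => (s \o j i)%VF | None => r end.
exists (fun i => jo (unlift ord0 i)); split=> [i|i||].
- by case: (unlift ord0 i) => [k|] //=; apply: rlinear_comp.
- case: (unlift ord0 i) => [k|]; apply/lker0E; last exact: (can_inj pr).
  move=> x y /=; rewrite !(comp_lfunE s) => sjxy.
  have /lker0E jinj := jk k; apply: jinj; exact: (can_inj qs) sjxy.
- have Lk i : limg (jo (unlift ord0 (lift ord0 i))) = (s @: limg (j i))%VS.
    by rewrite liftK /= limg_comp.
  have L0 : limg (jo (unlift ord0 ord0)) = limg r by rewrite unlift_none.
  apply/directv_sum_independent=> us usL us0.
  move: us0; rewrite big_ord_recl => us0.
  have [x _ u0E] : exists2 x, x \in fullv & us ord0 = r x.
    by apply/memv_imgP; rewrite -L0 usL.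
  have ukE i : us (lift ord0 i) = s (q (us (lift ord0 i))) /\
      q (us (lift ord0 i)) \in limg (j i).
    have /memv_imgP[y jy ->] : us (lift ord0 i) \in (s @: limg (j i))%VS.
      by rewrite -Lk usL.
    by rewrite qs.
  (* The projection [p] kills the terms coming from [Y] and isolates the first one; afterwards [q]
     carries the relation to [Y], where the images of the [j i] are independent. *)
  have x0 : x = 0.
    have := congr1 p us0; rewrite linear0 linearD /= u0E pr linear_sum big1 ?addr0 //.
    move=> i _; apply: etrans (ps (q (us (lift ord0 i)))).
    by rewrite -(ukE i).1.
  have u00 : us ord0 = 0 by rewrite u0E x0 linear0.
  move=> i _; case: (unliftP ord0 i) => [k|] -> //.
  move: us0; rewrite u00 add0r => /(congr1 q); rewrite linear0 linear_sum => qus0.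
  have /directv_sum_independent/(_ (fun i => q (us (lift ord0 i)))) qus := jdir.
  by rewrite (ukE k).1 qus ?linear0 // => m _; exact: (ukE m).2.
apply/vspaceP=> x; rewrite memvf [x]rpsq big_ord_recl unlift_none memv_add //.
  by rewrite memv_img ?memvf.
rewrite (eq_bigr (fun i => (s @: limg (j i))%VS)); last first.
  by move=> i _; rewrite liftK /= limg_comp.
by rewrite -limg_sum jT memv_img ?memvf.
Qed.

(** The existence half of Krull-Schmidt: indecomposable summands are split off one by one, and each
    lowers the dimension. *)
Lemma decomposition M : exists n (F : 'I_n -> rmod A),
  [/\ forall i, indecomposable (F i), is_dsum M F,
      forall i, split_mono (F i) M & \dim {:M} = (\sum_i \dim {:F i})%N].
Proof.
have [d] := ubnP (\dim {:M}); elim: d M => // d IHd M leMd.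
case: (classic (rzero M)) => [M0|nM0].
  exists 0%N, (fun=> M); split; [by case | | by case | by rewrite big_ord0].
  exact: is_dsum0.
have [X indX sX] := indec_split_summand nM0.
have [Y MXY] := split_mono_complement sX.
have := riso_dim MXY; rewrite dim_dsum => dM.
have X_gt0 := (rzeroPn X).1 indX.1.
have [|n [F [indF YF sF dY]]] := IHd Y; first by lia.
exists n.+1, (fun i => oapp F X (unlift ord0 i)); split=> [i||i|].
- by case: (unlift ord0 i) => [k|] /=; [exact: indF | exact: indX].
- exact: is_dsumS MXY YF.
- case: (unlift ord0 i) => //= k; apply: split_mono_trans (sF k) _.
  apply: split_mono_trans (split_mono_dsumr X Y) _.
  exact/split_mono_iso/riso_sym.
rewrite dM dY big_ord_recl unlift_none; congr (_ + _)%N.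
by apply: eq_bigr => i _; rewrite liftK.
Qed.

(** A cover rather than an enumeration: [F] may repeat a class or leave [C], so unions and products
    only change the index type. *)
Definition fin_iso (C : rmod A -> Prop) : Prop :=
  exists (I : finType) (F : I -> rmod A), forall M, C M -> exists i, riso M (F i).

Lemma fin_iso_cover (C : rmod A -> Prop) (I : finType) (D : I -> rmod A -> Prop) :
  (forall M, C M -> exists i, D i M) ->
  (forall i M N, D i M -> D i N -> riso M N) -> fin_iso C.
Proof.
move=> CD Diso; have [F DF] : exists F : I -> rmod A, forall i M, D i M -> D i (F i).
  apply: (@fin_all_exists _ (fun=> rmod A) (fun i X => forall M, D i M -> D i X)) => i.
  case: (classic (exists X, D i X)) => [[X DX]|noX]; first by exists X.
  (* A default representative for an index whose class [D i] is empty. *)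
  by exists (rmod0 A) => M DM; case: noX; exists M.
by exists I, F => M /CD[i DM]; exists i; apply: Diso (DM) _; exact: DF DM.
Qed.

Lemma fin_iso_union (C : rmod A -> Prop) (I : finType) (D : I -> rmod A -> Prop) :
  (forall M, C M -> exists i, D i M) -> (forall i, fin_iso (D i)) -> fin_iso C.
Proof.
move=> CD /fin_all_exists[J /fin_all_exists[F DF]].
exists {i : I & J i}, (fun t => F (tag t) (tagged t)) => M /CD[i /DF[j Mij]].
by exists (Tagged J j).
Qed.

Lemma fin_iso_dsum (C D : rmod A -> Prop) : fin_iso C -> fin_iso D ->
  fin_iso (fun M => exists X Y, [/\ C X, D Y & riso M (dsum X Y)]).
Proof.
case=> I [F CF] [J [G DG]]; exists (I * J)%type, (fun t => dsum (F t.1) (G t.2)).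
move=> M [X [Y [/CF[i Xi] /DG[j Yj] MXY]]]; exists (i, j).
exact: riso_trans MXY (riso_dsum Xi Yj).
Qed.

Lemma projective_split P X : rprojective P -> split_mono X P -> rprojective X.
Proof.
move=> projP [i [q [iA qA iK]]] Y Z g h gA gT hA.
have [h' h'A gh'] := projP Y Z g (h \o q)%VF gA gT (rlinear_comp qA hA).
exists (h' \o i)%VF; first exact: rlinear_comp.
by rewrite comp_lfunA gh' -comp_lfunA; apply/lfunP=> x; rewrite !comp_lfunE iK.
Qed.

(** Lifting [p] and [q] through each other gives maps [a] and [b] over [S]. Their composites are
    endomorphisms over a nonzero quotient, hence not nilpotent, hence injective by the Fitting
    lemma; equality of dimensions does the rest. *)
Lemma indec_projective_iso P Q S (p : 'Hom(P, S)) (q : 'Hom(Q, S)) :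
  indecomposable P -> indecomposable Q -> rprojective P -> rprojective Q ->
  ~ rzero S -> rlinear p -> rlinear q -> limg p = fullv -> limg q = fullv ->
  riso P Q.
Proof.
move=> indP indQ projP projQ nS0 pA qA pT qT.
have [a aA qa] := projP _ _ q p qA qT pA.
have [b bA pb] := projQ _ _ p q pA pT qA.
have qaE x : q (a x) = p x by rewrite -qa comp_lfunE.
have pbE x : p (b x) = q x by rewrite -pb comp_lfunE.
(* If some power of [h] were zero, then [r], which equals [r] after that power, would be zero
   although it maps onto [S]. *)
have inj (T : rmod A) (h : 'Hom(T, T)) (r : 'Hom(T, S)) : 
    indecomposable T -> rlinear h -> limg r = fullv ->
    (forall x, r (h x) = r x) -> injective h.
  move=> indT hA rT rh; apply/lker0E; case: (fitting indT hA) => // -[k hk0].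
  case: nS0; apply/eqP; rewrite dimv_eq0 -rT -subv0.
  apply/subvP=> _ /memv_imgP[x _ ->]; rewrite memv0; apply/eqP.
  have <- : r (iter k h x) = r x by elim: k {hk0} => //= k <-; rewrite rh.
  by rewrite hk0 linear0.
have ba_inj : injective (b \o a)%VF.
  by apply: inj indP (rlinear_comp aA bA) pT _ => x; rewrite comp_lfunE pbE qaE.
have ab_inj : injective (a \o b)%VF.
  by apply: inj indQ (rlinear_comp bA aA) qT _ => x; rewrite comp_lfunE qaE pbE.
have a_inj : injective a by move=> x y axy; apply: ba_inj; rewrite !comp_lfunE axy.
have b_inj : injective b by move=> x y bxy; apply: ab_inj; rewrite !comp_lfunE bxy.
exists a; split=> //; first exact/lker0E.
apply/eqP; rewrite eqEdim subvf /= limg_dim_eq ?(dim_injective b_inj) //.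
by have /lker0E-> := a_inj; rewrite capv0.
Qed.

Lemma fin_iso_indec_projective r : num_iso_classes (@rsimple K A) r ->
  fin_iso (fun P => indecomposable P /\ rprojective P).
Proof.
case=> S [simpS _ allS].
pose D i P := [/\ indecomposable P, rprojective P
  & exists p : 'Hom(P, S i), rlinear p /\ limg p = fullv].
apply: (@fin_iso_cover _ _ D) => [P [indP projP]|i P Q].
  have [T [p [simpT pA pT]]] := simple_quotient indP.1.
  have [i /riso_mutual[f [g [fA _ fK gK]]]] := allS _ simpT.
  exists i; split=> //; exists (f \o p)%VF; split; first exact: rlinear_comp.
  apply/limg_fullE=> y; have [x px] := (limg_fullE p).1 pT (g y).
  by exists x; rewrite comp_lfunE px gK.
case=> indP projP [p [pA pT]] [indQ projQ [q [qA qT]]].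
exact: (indec_projective_iso indP indQ projP projQ (simpS i).1 pA qA pT qT).
Qed.

(** A nonzero projective is the sum of an indecomposable projective and a projective of smaller
    dimension, so induction on [d] applies. *)
Lemma fin_iso_projective r d : num_iso_classes (@rsimple K A) r ->
  fin_iso (fun P => rprojective P /\ (\dim {:P} <= d)%N).
Proof.
move=> simp; elim: d => [|d IHd].
  exists unit, (fun=> rmod0 A) => P [_]; rewrite leqn0 => /eqP P0; exists tt.
  exact: rzero_iso P0 (rzero_rmod0 A).
pose D (b : bool) M := if b then rzero M else
  exists X Y, [/\ indecomposable X /\ rprojective X,
    rprojective Y /\ (\dim {:Y} <= d)%N & riso M (dsum X Y)].
apply: (@fin_iso_union _ _ D) => [P [projP leP]|[]].
- case: (classic (rzero P)) => [P0|nP0]; first by exists true.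
  exists false; have [X indX sX] := indec_split_summand nP0.
  have [Y PXY] := split_mono_complement sX; exists X, Y; split=> //.
    by split=> //; exact: projective_split sX.
  split; last first.
    by have := riso_dim PXY; have := (rzeroPn X).1 indX.1; rewrite dim_dsum; lia.
  apply: projective_split projP _; apply: split_mono_trans (split_mono_dsumr X Y) _.
  exact/split_mono_iso/riso_sym.
- exists unit, (fun=> rmod0 A) => P P0; exists tt; exact: rzero_iso P0 (rzero_rmod0 A).
exact: fin_iso_dsum (fin_iso_indec_projective simp) IHd.
Qed.

End Decomposition.

(** * Pencils of maps between projectives *)

Section Pencil.
Variable K : fieldType.

(** The solution is v (1 + t N)^-1. Multiplied by det (1 + t N) it becomes v adj (1 + t N), which is
    polynomial in [t]; the matrices [P], [w] and [Q] over K[X] carry these polynomials, and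
    [horner_eval t] specialises them. *)
Lemma pencil_mx n m (N : 'M[K]_n) (v : 'rV[K]_n) (B : 'I_n -> 'M[K]_m) :
  \det (\sum_j v 0 j *: B j) != 0 ->
  exists2 D : {poly K}, D != 0 & forall t, D.[t] != 0 ->
    exists w : 'rV[K]_n, w *m (1%:M + t *: N) = v /\
      \det (\sum_j w 0 j *: B j) != 0.
Proof.
move=> det_v.
pose P : 'M[{poly K}]_n := 1%:M + 'X *: map_mx polyC N.
pose w : 'rV[{poly K}]_n := map_mx polyC v *m \adj P.
pose Q : 'M[{poly K}]_m := \sum_j w 0 j *: map_mx polyC (B j).
have mapC t k l (C : 'M[K]_(k, l)) : map_mx (horner_eval t) (map_mx polyC C) = C.
  by apply/matrixP=> i j; rewrite !mxE /horner_eval hornerC.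
have P_t t : map_mx (horner_eval t) P = 1%:M + t *: N.
  by rewrite map_mxD map_mx1 map_mxZ mapC /= horner_evalE hornerX.
have Q_t t : map_mx (horner_eval t) Q =
    \sum_j (map_mx (horner_eval t) w) 0 j *: B j.
  rewrite raddf_sum; apply: eq_bigr => j _; rewrite [LHS]map_mxZ mapC.
  by congr (_ *: _); rewrite [RHS]mxE.
have w_t t : map_mx (horner_eval t) w = v *m \adj (1%:M + t *: N).
  by rewrite map_mxM mapC map_mx_adj P_t.
have det_t t k (C : 'M[{poly K}]_k) : (\det C).[t] = \det (map_mx (horner_eval t) C).
  by rewrite det_map_mx.
exists (\det P * \det Q) => [|t].
  (* The product is a nonzero polynomial because its value at 0 is the determinant assumed
     nonzero. *)
  apply: contra_neq det_v => D0; have := congr1 (fun p => p.[0]) D0.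
  rewrite hornerM !det_t P_t Q_t w_t scale0r addr0 det1 mul1r horner0 => <-.
  have adj1 : \adj (1%:M : 'M[K]_n) = 1%:M.
    by rewrite -[LHS]mulmx1 mul_adj_mx det1.
  by rewrite adj1 mulmx1.
rewrite hornerM mulf_eq0 negb_or !det_t P_t Q_t => /andP[dP dQ].
(* The cleared denominator is restored; it only rescales the second determinant by a nonzero
   factor. *)
exists ((\det (1%:M + t *: N))^-1 *: map_mx (horner_eval t) w); split.
  by rewrite w_t -scalemxAl -mulmxA mul_adj_mx mul_mx_scalar scalerA mulVf ?scale1r.
rewrite (eq_bigr (fun j => (\det (1%:M + t *: N))^-1 *:
   ((map_mx (horner_eval t) w) 0 j *: B j))); last by move=> j _; rewrite mxE scalerA.
by rewrite -scaler_sumr detZ mulf_neq0 // expf_neq0 // invr_neq0.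
Qed.

Lemma lker0_det (U : vectType K) (f : 'End(U)) :
  lker f = 0%VS <-> \det (lin1_mx (v2r \o f \o r2v)) != 0.
Proof.
have mE (x : 'rV[K]_(dim U)) : x *m lin1_mx (v2r \o f \o r2v) = v2r (f (r2v x)).
  by rewrite mul_rV_lin1.
split=> [/lker0E f_inj|].
  apply/negP=> /det0P[x x_neq0]; rewrite mE => fx0; case/eqP: x_neq0.
  apply: (can_inj (@r2vK _ U)); apply: f_inj; apply: v2r_inj.
  by rewrite fx0 !linear0.
move/det0P=> nker; apply/lker0E=> x y fxy; apply/eqP; rewrite -subr_eq0.
apply/negP=> nxy; apply: nker; exists (v2r (x - y)).
  by apply/eqP=> xy0; apply: nxy; rewrite -[x - y]v2rK xy0 linear0.
by rewrite mE v2rK linearB /= fxy subrr linear0.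
Qed.

(* Injectivity of [L w] is the nonvanishing of a determinant, which is
   polynomial in [t] once the denominator [det (1 + t N)] is cleared. *)
Lemma pencil (U V : vectType K) (N : 'End(V)) (L : {linear V -> 'End(U)}) (v : V) :
  lker (L v) = 0%VS ->
  exists2 D : {poly K}, D != 0 & forall t, D.[t] != 0 ->
    exists w, w + t *: N w = v /\ lker (L w) = 0%VS.
Proof.
pose mxL (w : V) := lin1_mx (v2r \o L w \o r2v).
have mxL_sum (w : 'rV[K]_(dim V)) :
    mxL (r2v w) = \sum_j w 0 j *: mxL (r2v (delta_mx 0 j)).
  apply/row_matrixP=> i; rewrite !rowE mulmx_sumr mul_rV_lin1 /=.
  rewrite {1}[w]row_sum_delta !linear_sum /= sum_lfunE linear_sum.
  apply: eq_bigr => j _; rewrite -scalemxAr mul_rV_lin1 /=.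
  by rewrite !linearZ /= scale_lfunE linearZ.
move=> /lker0_det Lv.
have [|D D_neq0 DP] := @pencil_mx _ _ (lin1_mx (v2r \o N \o r2v)) (v2r v)
    (fun j => mxL (r2v (delta_mx 0 j))).
  by rewrite -mxL_sum v2rK.
exists D => // t /DP[w [wv Lw]]; exists (r2v w); split.
  apply: v2r_inj; rewrite -wv mulmxDr mulmx1 -scalemxAr mul_rV_lin1 /=.
  by rewrite linearD linearZ /= r2vK.
by apply/lker0_det; rewrite -/(mxL _) mxL_sum.
Qed.

(** An infinite field has duplicate-free lists of every length, and one of length [size D] is too
    long to consist of roots of [D]. *)
Lemma finite_or_nonroot :
  (exists s : seq K, forall x, x \in s) \/
  (forall D : {poly K}, D != 0 -> exists t, D.[t] != 0).
Proof.
case: (classic (exists s : seq K, forall x, x \in s)) => [|infK]; [by left | right].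
have big n : exists2 s : seq K, uniq s & size s = n.
  elim: n => [|n [s s_uniq s_size]]; first by exists [::].
  have [x nsx] : exists x, x \notin s.
    apply: NNPP => nex; apply: infK; exists s => x.
    by apply/negP=> /negP nsx; apply: nex; exists x.
  by exists (x :: s); rewrite /= ?nsx ?s_size.
move=> D D_neq0; have [s s_uniq s_size] := big (size D).
have : ~~ all (root D) s.
  by apply/negP=> rs; have := max_poly_roots D_neq0 rs s_uniq; rewrite s_size ltnn.
by case/allPn=> t _; rewrite rootE; exists t.
Qed.

End Pencil.

(** * Rigid maps, their orbits and their cokernels *)

Section RigidMaps.
Variables (K : fieldType) (A : falgType K).
Implicit Types M N P Q X Y Z : rmod A.

(** For projective [P] and [Q] this is the presilting condition: every map from the two-term complex
    [f] to its shift by one is null-homotopic. *)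
Definition rigid_map P Q (f : 'Hom(P, Q)) : Prop := rlinear f /\
  forall h : 'Hom(P, Q), rlinear h -> exists (a : 'Hom(P, P)) (b : 'Hom(Q, Q)),
    [/\ rlinear a, rlinear b & h = (b \o f)%VF + (f \o a)%VF].

Section EndPair.
Variables P Q : rmod A.
Let V : vectType K := (subvs_of (rHom P P) * subvs_of (rHom Q Q))%type.

(** Packing both endomorphisms into one lets a single determinant control the injectivity of
    both. *)
Definition end_diag (w : V) : 'End((P * Q)%type) :=
  lpair (vsval w.1 \o lfst P Q)%VF (vsval w.2 \o lsnd P Q)%VF.

Fact end_diag_is_linear : linear end_diag.
Proof.
move=> k w z; apply/lfunP=> x; rewrite add_lfunE scale_lfunE !lpairE !comp_lfunE /=.
by rewrite !add_lfunE !scale_lfunE.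
Qed.

HB.instance Definition _ :=
  GRing.isLinear.Build K V 'End((P * Q)%type) _ end_diag end_diag_is_linear.

(** The defect of [w] as an intertwiner from [f] to [g]. For [g = f] it is the derivative at the
    identity of the orbit map of [f]. *)
Definition end_twist (f g : 'Hom(P, Q)) (w : V) : 'Hom(P, Q) :=
  ((vsval w.2 \o f) - (g \o vsval w.1))%VF.

Fact end_twist_is_linear f g : linear (end_twist f g).
Proof.
move=> k w z; rewrite /end_twist /=; apply/lfunP=> x.
rewrite !(add_lfunE, scale_lfunE, opp_lfunE, comp_lfunE) linearP.
by rewrite scalerBr opprD addrACA.
Qed.

HB.instance Definition _ f g :=
  GRing.isLinear.Build K V 'Hom(P, Q) _ (end_twist f g) (end_twist_is_linear f g).

(* The derivative of the action of [Aut P * Aut Q] at [f] being surjective,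
   the pencil [f + t g] stays in the orbit of [f] for all but finitely many
   [t]: with a section [s] of that derivative and [psi (a, b) = - g a], the
   vector [(1 + t s psi)^-1 (1, 1)] intertwines [f] and [f + t g]. *)
Lemma rigid_map_generic (f g : 'Hom(P, Q)) : rigid_map f -> rlinear g ->
  exists2 D : {poly K}, D != 0 & forall t, D.[t] != 0 ->
    exists (a : 'Hom(P, P)) (b : 'Hom(Q, Q)),
    [/\ rlinear b, lker a = 0%VS, lker b = 0%VS
      & (b \o f = (f + t *: g) \o a)%VF].
Proof.
case=> fA f_rigid gA.
pose phi := linfun (end_twist f f); pose psi := linfun (end_twist 0 g).
have surj h : rlinear h -> phi ((phi^-1)%VF h) = h.
  move=> hA; apply: limg_lfunVK; have [a [b [aA bA ->]]] := f_rigid h hA.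
  (* The sign of [a] turns the sum in the rigidity condition into the difference taken by
     [end_twist]. *)
  apply/memv_imgP; exists (vsproj (rHom P P) (- a), vsproj (rHom Q Q) b).
    by rewrite memvf.
  rewrite lfunE /= /end_twist /= !vsprojK ?comp_lfunNr ?opprK //; apply/rHomP => //.
  by rewrite -scaleN1r; apply: rlinear_scale.
have psiA w : rlinear (psi w).
  rewrite lfunE /= /end_twist comp_lfun0r sub0r -scaleN1r.
  apply/rlinear_scale/rlinear_comp => //; apply/rHomP; exact: subvsP.
pose v : V := (vsproj (rHom P P) \1%VF, vsproj (rHom Q Q) \1%VF).
have v1 : vsval v.1 = \1%VF by rewrite vsprojK //; apply/rHomP/rlinear_id.
have v2 : vsval v.2 = \1%VF by rewrite vsprojK //; apply/rHomP/rlinear_id.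
have diag_v : lker (end_diag v) = 0%VS.
  apply/lker0E=> -[x1 x2] [y1 y2]; rewrite !lpairE v1 v2 !comp_lfun1l.
  by rewrite !lfstE !lsndE.
have [D D_neq0 DP] := @pencil _ _ _ (phi^-1 \o psi)%VF end_diag v diag_v.
exists D => // t /DP[w [wE /lker0E w_inj]].
exists (vsval w.1), (vsval w.2); split.
- by apply/rHomP; exact: subvsP.
- apply/lker0E=> x y wxy; have := w_inj (x, 0) (y, 0).
  by rewrite !lpairE !comp_lfunE !lfstE !lsndE /= wxy => /(_ erefl)[].
- apply/lker0E=> x y wxy; have := w_inj (0, x) (0, y).
  by rewrite !lpairE !comp_lfunE !lfstE !lsndE /= wxy => /(_ erefl)[].
(* Applying [phi] to the equation for [w] removes the section, and [phi v = 0] because the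
   identities commute with [f]; what remains is the intertwining relation. *)
have := congr1 phi wE; rewrite linearD linearZ /= comp_lfunE surj // => phiw.
have phiv : phi v = 0.
  by rewrite lfunE /= /end_twist v1 v2 comp_lfun1l comp_lfun1r subrr.
move: phiw; rewrite phiv !lfunE /= /end_twist comp_lfun0r sub0r => e.
apply/eqP; rewrite comp_lfunDl -comp_lfunZl -subr_eq0 opprD addrA.
by rewrite -[X in _ == X]e scalerN.
Qed.

End EndPair.

(** The sections [p^-1] and [q^-1] are only linear over [K], but their failure to be A-linear lies
    in the common kernel and disappears in [q \o p^-1] and [p \o q^-1]. *)
Lemma coker_iso P M N (p : 'Hom(P, M)) (q : 'Hom(P, N)) :
  rlinear p -> rlinear q -> limg p = fullv -> limg q = fullv ->
  lker p = lker q -> riso M N.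
Proof.
move=> pA qA pT qT pq.
have pV x : p ((p^-1)%VF x) = x by rewrite limg_lfunVK // pT memvf.
have qV x : q ((q^-1)%VF x) = x by rewrite limg_lfunVK // qT memvf.
have qpE x : q ((p^-1)%VF (p x)) = q x.
  by apply/eqP; rewrite -subr_eq0 -linearB -memv_ker -pq memv_ker linearB /= pV subrr.
have pqE x : p ((q^-1)%VF (q x)) = p x.
  by apply/eqP; rewrite -subr_eq0 -linearB -memv_ker pq memv_ker linearB /= qV subrr.
apply: (@mutual_riso _ _ _ _ (q \o p^-1)%VF (p \o q^-1)%VF) => [a x|x|x].
- by rewrite !comp_lfunE -{1}(pV x) -pA qpE qA.
- by rewrite !comp_lfunE pqE pV.
by rewrite !comp_lfunE qpE qV.
Qed.

(** Injective endomorphisms are bijective in finite dimension, so [b] carries the image of [f] onto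
    that of [x], and [q \o b] is another cokernel of [f]. *)
Lemma intertwined_coker_iso P Q (f x : 'Hom(P, Q)) (a : 'Hom(P, P)) (b : 'Hom(Q, Q))
    M N (p : 'Hom(Q, M)) (q : 'Hom(Q, N)) :
  rlinear b -> lker a = 0%VS -> lker b = 0%VS -> (b \o f = x \o a)%VF ->
  rlinear p -> rlinear q -> limg p = fullv -> limg q = fullv ->
  lker p = limg f -> lker q = limg x -> riso M N.
Proof.
move=> bA ka kb bfxa pA qA pT qT pf qx.
have aT : limg a = fullv by apply: lker0_limgf; rewrite ka.
have bT : limg b = fullv by apply: lker0_limgf; rewrite kb.
apply: (@coker_iso _ _ _ p (q \o b)%VF) => //; first exact: rlinear_comp.
  by rewrite limg_comp bT.
apply/vspaceP=> y; rewrite pf [in RHS]memv_ker comp_lfunE -memv_ker qx.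
have -> : limg x = (b @: limg f)%VS by rewrite -limg_comp bfxa limg_comp aT.
by rewrite memvE [RHS]memvE -limg_line limg_ker0 ?kb.
Qed.

Definition rigid_coker P Q M : Prop := exists (f : 'Hom(P, Q)) (p : 'Hom(Q, M)),
  [/\ rigid_map f, rlinear p, limg p = fullv & lker p = limg f].

Lemma rigid_coker_unique P Q M N :
  (forall D : {poly K}, D != 0 -> exists t, D.[t] != 0) ->
  rigid_coker P Q M -> rigid_coker P Q N -> riso M N.
Proof.
move=> infK [f [p [f_rigid pA pT pf]]] [g [q [g_rigid qA qT qg]]].
have [fA _] := f_rigid; have [gA _] := g_rigid.
have [D D_neq0 DP] := rigid_map_generic f_rigid (rlinear_sub gA fA).
have [E E_neq0 EP] := rigid_map_generic g_rigid (rlinear_sub fA gA).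
(* The point with parameter [t] on the line from [f] to [g] has parameter [1 - t] when the line is
   run from [g] to [f]. *)
have E'_neq0 : E \Po (1 - 'X) != 0.
  by rewrite comp_poly2_eq0 // -opprB size_polyN size_XsubC.
have [t] := infK _ (mulf_neq0 D_neq0 E'_neq0).
rewrite hornerM mulf_eq0 negb_or horner_comp !hornerE => /andP[/DP + /EP].
case=> [a [b [bA ka kb abE]]] [a' [b' [b'A ka' kb' ab'E]]].
set x := f + t *: (g - f) in abE.
have xE : g + (1 - t) *: (f - g) = x.
  by rewrite /x scalerBl scale1r addrA [g + (f - g)]addrC subrK -scalerN opprB.
have xA : rlinear x by apply/rlinear_add/rlinear_scale/rlinear_sub.
rewrite xE in ab'E.
(* The cokernel of the common point [x] is compared with both modules. *)
have [X [r [rA rT rx]]] := quotient_exists (rsub_img xA (@rsub_full _ _ P)).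
apply: (riso_trans (N := X)).
  exact: (intertwined_coker_iso bA ka kb abE pA rA pT rT pf rx).
apply: riso_sym.
exact: (intertwined_coker_iso b'A ka' kb' ab'E qA rA qT rT qg rx).
Qed.

Lemma fin_iso_rigid_coker P Q : fin_iso (rigid_coker P Q).
Proof.
have [[s sK]|infK] := finite_or_nonroot K; last first.
  apply: (@fin_iso_cover _ _ _ unit (fun=> rigid_coker P Q)) => [M RM|_ M N].
    by exists tt.
  exact: rigid_coker_unique.
(* Over a finite field the coordinates of a map range over the list [s], so finitely many maps
   occur, each with one cokernel up to isomorphism. *)
pose e := vbasis {: 'Hom(P, Q)}.
pose map_of (c : {ffun 'I_(\dim {: 'Hom(P, Q)}) -> seq_sub s}) : 'Hom(P, Q) :=
  \sum_i ssval (c i) *: e`_i.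
apply: (@fin_iso_cover _ _ _ _ (fun c M => exists p : 'Hom(Q, M),
    [/\ rlinear p, limg p = fullv & lker p = limg (map_of c)])) => [M|c M N].
  case=> f [p [_ pA pT pf]]; exists [ffun i => SeqSub (sK (coord e i f))], p.
  split=> //; rewrite pf; congr (limg _); rewrite {1}(coord_vbasis (memvf f)).
  by apply: eq_bigr => i _; rewrite ffunE.
by case=> p [pA pT pc] [q [qA qT qc]]; apply: coker_iso pA qA pT qT _; rewrite pc.
Qed.

End RigidMaps.

(** * Presentations of tau-rigid modules *)

Lemma separating_functional (K : fieldType) (V : vectType K) (U : {vspace V}) x :
  x \notin U -> exists l : 'Hom(V, K^o), (forall y, y \in U -> l y = 0) /\ l x != 0.
Proof.
(* The functional is a coordinate that does not vanish on the part [y] of [x] off [U], composed with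
   the projection that kills [U]. *)
move=> nUx; pose y := x - projv U x.
have y_neq0 : y != 0.
  by apply: contraNneq nUx => /eqP; rewrite subr_eq0 => /eqP->; exact: memv_proj.
pose e := vbasis {:V}.
have [i ei] : exists i, coord e i y != 0.
  apply: NNPP => noi; case/eqP: y_neq0; rewrite (coord_vbasis (memvf y)).
  apply: big1 => i _; case: (eqVneq (coord e i y) 0) => [->|nz].
    by rewrite scale0r.
  by case: noi; exists i.
exists (linfun (coord e i : V -> K^o) \o (\1 - projv U))%VF; split=> [z Uz|].
  rewrite comp_lfunE add_lfunE opp_lfunE id_lfunE projv_id // subrr.
  by rewrite linear0.
by rewrite comp_lfunE add_lfunE opp_lfunE id_lfunE lfunE.
Qed.

Section TauRigid.
Variables (K : fieldType) (A : falgType K).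
Implicit Types M N P Q X Y Z T : rmod A.

Definition freemod n : rmod A := iter n (dsum (reg A)) (rmod0 A).

Lemma freemod_cover P (s : seq P) : exists q : 'Hom(freemod (size s), P),
  rlinear q /\ {subset s <= limg q}.
Proof.
elim: s => [|x s [q [qA sq]]]; first by exists 0; split; first exact: rlinear0.
exists (((linfun (ract_app x) : 'Hom(reg A, P)) \o lfst (reg A) (freemod (size s)))
         + (q \o lsnd (reg A) (freemod (size s))))%VF; split.
  apply: rlinear_add; apply: rlinear_comp; rewrite //.
  - exact: rlinear_fst.
  - by move=> a y; rewrite !lfunE /= /ract_app ?lfunE /= ractME.
  - exact: rlinear_snd.
move=> y; rewrite inE => /orP[/eqP->|/sq/memv_imgP[z _ ->]]; apply/memv_imgP.
  exists (1, 0); rewrite ?memvf // add_lfunE !comp_lfunE lfstE lsndE /= linear0 addr0.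
  by rewrite lfunE /= /ract_app ract1E.
exists (0, z); rewrite ?memvf // add_lfunE !comp_lfunE lfstE lsndE /= linear0.
by rewrite add0r.
Qed.

(** The image of the tensor of [m] and [g] under the canonical map from the tensor product of M and
    Hom_A(P, A) over A to Hom_A(P, M). *)
Definition tensor_map P M (m : M) (g : rdual P) : 'Hom(P, M) :=
  (linfun (ract_app m) \o vsval g)%VF.

Lemma tensor_mapE P M (m : M) (g : rdual P) x :
  tensor_map m g x = ract M (vsval g x) m.
Proof. by rewrite comp_lfunE lfunE. Qed.

Lemma rlinear_tensor_map P M (m : M) (g : rdual P) : rlinear (tensor_map m g).
Proof.
move=> a x; rewrite !tensor_mapE; have /rHomP-> := subvsP g.
by rewrite /= lfunE /= ractME.
Qed.

(** As [P] is a retract of a free module, [h] factors through that free module and is thus a sum of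
    maps [tensor_map m g]. This is the surjectivity of the canonical map onto Hom_A(P, M), tested on
    functionals. *)
Lemma functional_projective P M (l : 'Hom('Hom(P, M), K^o)) :
  rprojective P -> (forall m g, l (tensor_map m g) = 0) ->
  forall h, rlinear h -> l h = 0.
Proof.
move=> projP l0 h hA.
have l_free n : forall (s : 'Hom(P, freemod n)) (k : 'Hom(freemod n, M)),
    rlinear s -> rlinear k -> l (k \o s)%VF = 0.
  elim: n => [|n IHn] s k sA kA.
    suff -> : s = 0 by rewrite comp_lfun0r linear0.
    apply/lfunP=> x; rewrite zero_lfunE; apply/eqP; rewrite -memv0.
    have /eqP := rzero_rmod0 A; rewrite dimv_eq0 => /eqP<-; exact: memvf.
  pose F := freemod n.
  pose inl : 'Hom(reg A, freemod n.+1) := lpair \1%VF (0 : 'Hom(reg A, F)).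
  pose inr : 'Hom(F, freemod n.+1) := lpair (0 : 'Hom(F, reg A)) \1%VF.
  pose pl : 'Hom(freemod n.+1, reg A) := lfst (reg A) F.
  pose pr : 'Hom(freemod n.+1, F) := lsnd (reg A) F.
  have plA : rlinear pl by exact: rlinear_fst.
  have prA : rlinear pr by exact: rlinear_snd.
  have inlA : rlinear inl.
    by apply: rlinear_pair; [exact: rlinear_id | exact: rlinear0].
  have inrA : rlinear inr.
    by apply: rlinear_pair; [exact: rlinear0 | exact: rlinear_id].
  pose g := vsproj (rHom P (reg A)) (pl \o s)%VF.
  have gE : vsval g = (pl \o s)%VF.
    by rewrite vsprojK //; apply/rHomP; exact: rlinear_comp.
  have sE y : y = ract (freemod n.+1) (pl y) (inl 1) + inr (pr y).
    rewrite -inlA !lpairE lfstE lsndE !id_lfunE !zero_lfunE /= lfunE /= mul1r.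
    by case: y => a c; congr (_, _); rewrite ?addr0 ?add0r.
  (* The first free coordinate contributes one tensor, of the image under [k] of its generator with
     the first component of [s]; the rest factors through [freemod n]. *)
  have -> : (k \o s)%VF = tensor_map (k (inl 1)) g + ((k \o inr) \o (pr \o s))%VF.
    apply/lfunP=> x; rewrite add_lfunE tensor_mapE gE !comp_lfunE -kA -linearD.
    by rewrite -sE.
  rewrite linearD /= l0 add0r; apply: IHn.
    exact: rlinear_comp sA prA.
  exact: rlinear_comp inrA kA.
have [q [qA sq]] := freemod_cover (vbasis {:P}).
have qT : limg q = fullv.
  apply/eqP; rewrite eqEsubv subvf /=; apply: subv_trans (introT span_subvP sq).
  by rewrite (span_basis (vbasisP _)).
have [s sA qs] := projP _ _ q \1%VF qA qT (@rlinear_id _ _ P).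
have -> : h = ((h \o q) \o s)%VF by rewrite -comp_lfunA qs comp_lfun1r.
by apply: l_free => //; exact: rlinear_comp.
Qed.

Lemma nak_mapE P Q (f : 'Hom(P, Q)) (phi : nak P) (g : rdual Q) :
  (nak_map f phi : 'Hom(rdual Q, K^o)) g =
  (phi : 'Hom(rdual P, K^o)) (rdual_map f g).
Proof. by rewrite lfunE /= /nak_fun comp_lfunE lfunE. Qed.

(** * The Auslander-Reiten pairing for the Nakayama functor *)

Section AuslanderReiten.
Variables (P M : rmod A) (l : 'Hom('Hom(P, M), K^o)).

Definition ar_fun (m : M) (g : rdual P) : K^o := l (tensor_map m g).

Fact ar_fun_is_linear m : linear (ar_fun m).
Proof.
move=> k g h; rewrite /ar_fun -linearP; congr (l _).
by rewrite /tensor_map (linearP vsval) /= comp_lfunDr comp_lfunZr.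
Qed.

HB.instance Definition _ m :=
  GRing.isLinear.Build K (rdual P) K^o _ (ar_fun m) (ar_fun_is_linear m).

Definition ar_map_fun (m : M) : nak P := linfun (ar_fun m).

Fact ar_map_is_linear : linear ar_map_fun.
Proof.
move=> k m n; apply/lfunP=> g; rewrite add_lfunE scale_lfunE !lfunE /=.
rewrite /ar_fun -linearP; congr (l _); apply/lfunP=> x.
by rewrite add_lfunE scale_lfunE !tensor_mapE linearP.
Qed.

HB.instance Definition _ :=
  GRing.isLinear.Build K M (nak P) _ ar_map_fun ar_map_is_linear.

(** The map M -> nu P attached to [l] by the comparison D Hom_A(P, M) -> Hom_A(M, nu P), with D the
    dual over [K]. *)
Definition ar_map : 'Hom(M, nak P) := linfun ar_map_fun.

Lemma ar_mapE m g : (ar_map m : 'Hom(rdual P, K^o)) g = l (tensor_map m g).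
Proof. by rewrite lfunE /= lfunE. Qed.

Lemma ar_map_rlinear : rlinear ar_map.
Proof.
move=> a m; apply/lfunP=> g; rewrite nak_ractE !ar_mapE; congr (l _).
apply/lfunP=> x; rewrite !tensor_mapE rdual_lactE comp_lfunE lfunE /=.
by rewrite ractME.
Qed.

End AuslanderReiten.

Definition precomp P Q M (f : 'Hom(P, Q)) (b : 'Hom(Q, M)) : 'Hom(P, M) :=
  (b \o f)%VF.

Fact precomp_is_linear P Q M (f : 'Hom(P, Q)) : linear (@precomp P Q M f).
Proof. by move=> k b c; rewrite /precomp comp_lfunDl comp_lfunZl. Qed.

HB.instance Definition _ P Q M (f : 'Hom(P, Q)) :=
  GRing.isLinear.Build K 'Hom(Q, M) 'Hom(P, M) _ (@precomp P Q M f)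
    (@precomp_is_linear P Q M f).

(* A functional on [Hom(P1, M)] vanishing on the maps that factor through [f]
   induces a map from [M] to the kernel [T] of [nak P1 -> nak P0], hence is zero. *)
Lemma tau_rigid_extension M T P1 P0 (f : 'Hom(P1, P0)) (i : 'Hom(T, nak P1)) :
  rprojective P1 -> rlinear f -> rlinear i -> lker i = 0%VS ->
  limg i = lker (nak_map f) -> rHom M T = 0%VS ->
  forall h : 'Hom(P1, M), rlinear h ->
    exists2 b : 'Hom(P0, M), rlinear b & h = (b \o f)%VF.
Proof.
move=> projP1 fA iA ki iE MT0 h hA.
pose U := (linfun (@precomp P1 P0 M f) @: rHom P0 M)%VS.
have UP u : u \in U <-> exists2 b, rlinear b & u = (b \o f)%VF.
  split=> [/memv_imgP[b /rHomP bA ->]|[b bA ->]]; first by exists b; rewrite ?lfunE.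
  by apply/memv_imgP; exists b; rewrite ?lfunE //; apply/rHomP.
apply/UP; apply: contraT => /separating_functional[l [lU lh]].
case/eqP: lh; apply: (functional_projective projP1 _ hA) => m g.
suff -> : l (tensor_map m g) = 0 by [].
rewrite -ar_mapE; suff -> : ar_map l m = 0 by rewrite zero_lfunE.
(* On [ar_map l n] the map [nak_map f] takes the values of [l] on tensor maps precomposed with [f],
   and these lie in [U]. *)
have ar_ker n : ar_map l n \in limg i.
  rewrite iE memv_ker; apply/eqP/lfunP=> k.
  rewrite nak_mapE ar_mapE zero_lfunE; apply: lU.
  apply/UP; exists (tensor_map n k); first exact: rlinear_tensor_map.
  by rewrite /tensor_map rdual_mapE // comp_lfunA.
have iV n : i ((i^-1)%VF (ar_map l n)) = ar_map l n by rewrite limg_lfunVK.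
have : (i^-1 \o ar_map l)%VF \in rHom M T.
  apply/rHomP=> a n; have /lker0E := ki; apply.
  by rewrite !comp_lfunE iV iA iV ar_map_rlinear.
rewrite MT0 memv0 => /eqP/lfunP/(_ m); rewrite comp_lfunE zero_lfunE => iVm0.
by rewrite -[LHS]iV iVm0 linear0.
Qed.

(** Lifts of a basis of the image generate a submodule that spans [P] together with the kernel,
    hence equals [P]; each generator contributes at most the dimension of [A]. *)
Lemma superfluous_dim P M (p : 'Hom(P, M)) : rlinear p -> superfluous (lker p) ->
  (\dim {:P} <= \dim (limg p) * \dim {:A})%N.
Proof.
move=> pA sup; pose b := vbasis (limg p); pose y i := (p^-1)%VF b`_i.
pose W := (\sum_(i < \dim (limg p)) cyclic (y i))%VS.
have sW : rsub W.
  rewrite /W; elim/big_rec: _ => [|i V _ sV]; first exact: rsub0.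
  by apply: rsub_add => //; exact: rsub_cyclic.
have WT : W = fullv.
  apply: sup => //; apply/vspaceP=> x; rewrite memvf.
  pose z := \sum_(i < \dim (limg p)) coord b i (p x) *: y i.
  have pz : p z = p x.
    rewrite [RHS](coord_vbasis (memv_img p (memvf x))) linear_sum.
    apply: eq_bigr => i _; rewrite linearZ /= limg_lfunVK //.
    by apply: vbasis_mem; rewrite mem_nth ?size_tuple.
  rewrite -[x](subrK z) addrC memv_add //.
    by apply: memv_sumr => i _; rewrite memvZ // mem_cyclic.
  by rewrite memv_ker linearB /= pz subrr.
rewrite -[X in (\dim X <= _)%N]WT; apply: leq_trans (dimv_leq_sum _ _ _) _.
apply: (@leq_trans (\sum_(i < \dim (limg p)) \dim {:A})%N).
  by apply: leq_sum => i _; exact: dim_cyclic.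
by rewrite sum_nat_const card_ord.
Qed.

(** For h : P1 -> P0, the composite [p \o h] extends along [f] to a map P0 -> M, which lifts to an
    endomorphism [b] of [P0]. Then h - b f lands in ker p = im f and lifts through [f] to an
    endomorphism [a] of [P1]. *)
Lemma tau_rigid_presentation M : tau_rigid M -> exists P1 P0,
  [/\ rprojective P1 /\ (\dim {:P1} <= \dim {:M} * \dim {:A} * \dim {:A})%N,
      rprojective P0 /\ (\dim {:P0} <= \dim {:M} * \dim {:A})%N
    & rigid_coker P1 P0 M].
Proof.
case=> T [[P1 [P0 [f [p [i [[[projP1 projP0 fA pA] pT fp supp supf]]]]]]]].
case=> iA ki iE MT0; exists P1, P0.
have leP0 : (\dim {:P0} <= \dim {:M} * \dim {:A})%N.
  by have := superfluous_dim pA supp; rewrite pT.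
split=> //.
  split=> //; apply: leq_trans (superfluous_dim fA supf) _.
  by rewrite leq_mul2r (leq_trans _ leP0) ?dimvS ?subvf ?orbT.
exists f, p; split=> //; split=> // h hA.
have [b' b'A phE] := tau_rigid_extension projP1 fA iA ki iE MT0 (rlinear_comp hA pA).
have [b bA pb] := projP0 _ _ p b' pA pT b'A.
have sk := rsub_ker pA.
(* Both h - b f and [f] are corestricted to ker p, where [f] becomes onto and projectivity of [P1]
   applies. *)
pose k : 'Hom(P1, submod sk) := (linfun (vsproj (lker p)) \o (h - (b \o f)))%VF.
pose f' : 'Hom(P1, submod sk) := (linfun (vsproj (lker p)) \o f)%VF.
have kE x : vsval (k x) = h x - b (f x).
  rewrite comp_lfunE lfunE /= vsprojK add_lfunE opp_lfunE comp_lfunE //.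
  rewrite memv_ker linearB /= -!comp_lfunE phE -pb !comp_lfunE.
  by rewrite subrr.
have f'E x : vsval (f' x) = f x.
  by rewrite comp_lfunE lfunE /= vsprojK // -fp memv_img ?memvf.
have kA : rlinear k.
  move=> a x; apply: val_inj; apply: etrans (kE _) (esym (etrans (sub_ractE sk _ _) _)).
  by apply: etrans (congr1 (ract P0 a) (kE x)) _; rewrite linearB /= hA fA bA.
have f'A : rlinear f'.
  move=> a x; apply: val_inj; apply: etrans (f'E _) _.
  by rewrite fA -f'E -sub_ractE.
have f'T : limg f' = fullv.
  apply/limg_fullE=> y.
  have /memv_imgP[x _ yE] : vsval y \in limg f by rewrite fp; exact: subvsP.
  by exists x; apply: val_inj; apply: etrans (f'E _) _.
have [a aA f'a] := projP1 _ _ f' k f'A f'T kA.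
exists a, b; split=> //; apply/lfunP=> x; rewrite add_lfunE !comp_lfunE.
have -> : f (a x) = h x - b (f x) by rewrite -f'E -kE -f'a comp_lfunE.
by rewrite addrC subrK.
Qed.

Lemma rigid_coker_transport P P' Q Q' M : riso P P' -> riso Q Q' ->
  rigid_coker P Q M -> rigid_coker P' Q' M.
Proof.
case/riso_mutual=> u [u' [uA u'A uK u'K]] /riso_mutual[v [v' [vA v'A vK v'K]]].
case=> f [p [[fA f_rigid] pA pT pf]].
exists (v \o f \o u')%VF, (p \o v')%VF; split.
- split=> [|h hA]; first by do 2!apply: rlinear_comp => //.
  have [a [b [aA bA hE]]] := f_rigid (v' \o h \o u)%VF
    (rlinear_comp uA (rlinear_comp hA v'A)).
  exists (u \o a \o u')%VF, (v \o b \o v')%VF.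
  split; try by do 2!apply: rlinear_comp => //.
  apply/lfunP=> x; have /lfunP/(_ (u' x)) := hE.
  rewrite !(add_lfunE, comp_lfunE) u'K => /(congr1 v); rewrite v'K => ->.
  by rewrite linearD /= vK uK.
- exact: rlinear_comp.
- apply/limg_fullE=> y; have [x <-] := (limg_fullE p).1 pT y.
  by exists (v x); rewrite comp_lfunE vK.
apply/vspaceP=> y; rewrite memv_ker comp_lfunE -memv_ker pf.
apply/memv_imgP/memv_imgP=> [[x _ yE]|[x _ ->]].
  by exists (u x); rewrite ?memvf // !comp_lfunE uK -yE v'K.
by exists (u' x); rewrite ?memvf // !comp_lfunE vK.
Qed.

Lemma fin_iso_tau_rigid r d : num_iso_classes (@rsimple K A) r ->
  fin_iso (fun M => tau_rigid M /\ (\dim {:M} <= d)%N).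
Proof.
move=> simp.
have [I [F FP]] := fin_iso_projective (d * \dim {:A} * \dim {:A}) simp.
have [J [G GP]] := fin_iso_projective (d * \dim {:A}) simp.
apply: (@fin_iso_union _ _ _ (I * J)%type (fun t => rigid_coker (F t.1) (G t.2))).
  move=> M [/tau_rigid_presentation[P1 [P0 [[pr1 d1] [pr0 d0] rM]]] dM].
  have [|i P1i] := FP P1.
    by split=> //; apply: leq_trans d1 _; rewrite !leq_mul.
  have [|j P0j] := GP P0.
    by split=> //; apply: leq_trans d0 _; rewrite leq_mul.
  by exists (i, j); exact: rigid_coker_transport P1i P0j rM.
by move=> t; exact: fin_iso_rigid_coker.
Qed.

(** * Bounding the members of tau-tilting pairs *)

Lemma noniso_family_leq (C : rmod A -> Prop) m n (F : 'I_n -> rmod A) :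
  num_iso_classes C m -> (forall i, C (F i)) ->
  (forall i j, riso (F i) (F j) -> i = j) -> (n <= m)%N.
Proof.
case=> G [_ _ CG] CF Finj.
have [k Fk] := fin_all_exists (fun i => CG _ (CF i)).
have := @leq_card _ _ k; rewrite !card_ord; apply => i j kij; apply: Finj.
by apply: riso_trans (Fk i) _; rewrite kij; exact: riso_sym.
Qed.

(** Since [M] is basic, its indecomposable summands are pairwise non-isomorphic summands of [N], so
    there are at most [r] of them. *)
Lemma basic_summand_dim M N r b : basic M -> split_mono M N ->
  num_iso_classes (indec_summand N) r ->
  (forall X, indecomposable X -> \dim {:X} <= b)%N -> (\dim {:M} <= r * b)%N.
Proof.
move=> basicM sMN numN bound; have [n [F [indF MF sF ->]]] := decomposition M.
have len : (n <= r)%N.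
  apply: noniso_family_leq numN _ (basicM _ _ indF MF) => i; split=> //.
  exact/split_mono_complement/(split_mono_trans (sF i)).
apply: (@leq_trans (\sum_(i < n) b)%N); first by apply: leq_sum => i _; exact: bound.
by rewrite sum_nat_const card_ord leq_mul.
Qed.

Lemma bounded_tau_tilting_finite b :
  (forall X : rmod A, indecomposable X -> \dim {:X} <= b)%N -> tau_tilting_finite A.
Proof.
move=> bound.
(* The finite number of simple modules is read off from one tau-tilting pair; if there is no pair,
   the empty list suffices. *)
case: (classic (exists M P : rmod A, tau_tilting_pair M P)) => [|noMP]; last first.
  by exists 0%N, (fun=> (rmod0 A, rmod0 A)) => M P MP; case: noMP; exists M, P.
case=> M0 [P0 [_ [r0 [simp0 _]]]].
have [I [F FP]] := fin_iso_tau_rigid (r0 * b) simp0.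
have [J [G GP]] := fin_iso_projective (r0 * b) simp0.
exists #|{: I * J}|, (fun t => (F (enum_val t).1, G (enum_val t).2)) => M P.
case=> [[basicM basicP projP tauM _] [r [simp sumMP]]].
(* Both numbers count the simple modules, so the bound [r0 * b], fixed in advance, serves every
   pair. *)
have ler : (r <= r0)%N.
  by have [S [simpS Sinj _]] := simp; exact: noniso_family_leq simp0 simpS Sinj.
have dimM := basic_summand_dim basicM (split_mono_dsuml M P) sumMP bound.
have dimP := basic_summand_dim basicP (split_mono_dsumr M P) sumMP bound.
have [|i Mi] := FP M; first by split=> //; apply: leq_trans dimM _; rewrite leq_mul.
have [|j Pj] := GP P; first by split=> //; apply: leq_trans dimP _; rewrite leq_mul.
by exists (enum_rank (i, j)); rewrite enum_rankK.
Qed.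

End TauRigid.

Local Close Scope ring_scope.

Theorem corollary1p2 (K : fieldType) (A : falgType K) :
  tau_tilting_infinite A ->
  forall t : nat, 0 < t ->
    exists M : rmod A,
      indecomposable M /\ exists n : nat, has_length M n /\ t <= n.
Proof.
move=> infA t t_gt0; apply: NNPP => noM; apply: infA.
(* By [noM] every indecomposable has length below [t], so [has_length_dim] gives this bound on its
   dimension. *)
apply: (@bounded_tau_tilting_finite _ _ (t * \dim {:A})) => X indX.
have [n lenX] := has_length_exists X.
apply: leq_trans (has_length_dim lenX) _; rewrite leq_mul2r.
case: (leqP t n) => [letn|/ltnW->]; last by rewrite orbT.
by case: noM; exists X; split=> //; exists n.
Qed.
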